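(* Under the standing setup in the context, assume that for every $k\ge\bar\kappa$: (C1) $\eta_k(\mu+L)+\gamma_k\rho_N\le 2$; (C2) $\dfrac{\eta_k}{\gamma_k}\le \dfrac{\zeta\,\mu\rho_2}{\sqrt N\,\nabla^* L}$; (C3) $\dfrac{\gamma_k}{\eta_k}\le\dfrac{\gamma_{k+1}}{\eta_{k+1}}$. Then for every $k\ge\bar\kappa$: $$\frac{1}{\sqrt N}\|\mathbf W_k-\overline{\mathbf W}_k\|_{\mathbb E}\le\Big[\sum_{t=\bar\kappa}^{k-1}P_{tk}^2\big(\gamma_t^2\Sigma^{(1)}+\eta_t^2\Sigma^{(2)}\big)\Big]^{1/2},$$ $$\frac{1}{\sqrt N}\|\overline{\mathbf W}_k-\mathbf W_k^*\|_{\mathbb E}\le \mathrm{dm}(\mathcal W)\,P_{(\bar\kappa-1)k}+\frac{\nabla^*L}{\mu\rho_2}\sum_{t=\bar\kappa}^{k-1}P_{tk}\Big(1+\frac{L^2}{\mu\rho_2}\frac{\eta_t}{\gamma_t}\Big)\Big(\frac{\eta_t}{\gamma_t}-\frac{\eta_{t+1}}{\gamma_{t+1}}\Big),$$ $$\frac{1}{\sqrt N}\|\mathbf W_k^*-\mathbf W^*\|\le\frac{\nabla^*L}{\mu\rho_2}\,\frac{\eta_k}{\gamma_k},$$ where $P_{tk}\triangleq\prod_{j=t+1}^{k-1}(1-\mu\eta_j)$ for $t\le k-1$ (empty product $=1$).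
   Context: Standing setup. Let $N\ge2$, $d\ge1$. For $i=1,\dots,N$, $f_i:\mathbb R^d\to\mathbb R$ is $\mu$-strongly convex and $L$-smooth (gradient $L$-Lipschitz), $0<\mu\le L$. Let $F(\mathbf w)=\frac1N\sum_i f_i(\mathbf w)$ with unique minimizer $\mathbf w^*\in\mathbb R^d$. Let $\mathcal W\subset\mathbb R^d$ be nonempty, closed, convex, bounded with $\mathbf w^*\in\mathrm{int}(\mathcal W)$; $\zeta\triangleq\min_{\mathbf w\in\mathrm{bd}(\mathcal W)}\|\mathbf w-\mathbf w^*\|>0$; $\mathrm{dm}(\mathcal W)\triangleq\max_{\mathbf w,\mathbf w'\in\mathcal W}\|\mathbf w-\mathbf w'\|$; $\nabla^*\triangleq\max_i\|\nabla f_i(\mathbf w^* )\|$. Let $\mathbf L\in\mathbb R^{N\times N}$ be a Laplacian matrix: symmetric, off-diagonal entries $\le0$, $\mathbf L\mathbf 1_N=\mathbf 0$; its eigenvalues are $0=\rho_1\le\rho_2\le\dots\le\rho_N$, and $\rho_2>0$. Set $\hat{\mathbf L}=\mathbf L\otimes\mathbf I_d$. For $\mathbf W=[\mathbf w_1^\top,\dots,\mathbf w_N^\top]^\top\in\mathbb R^{Nd}$ let $f(\mathbf W)=\sum_i f_i(\mathbf w_i)$, and $\mathbf W^*=\mathbf 1_N\otimes\mathbf w^*$. $\Pi^N$ denotes Euclidean projection onto $\mathcal W^N$. Given stepsizes $\eta_k,\gamma_k>0$, define $G_k(\mathbf W)=f(\mathbf W)+\frac{\gamma_k}{2\eta_k}\mathbf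 W^\top\hat{\mathbf L}\mathbf W$ and $\mathbf W_k^*=\arg\min_{\mathbf W\in\mathcal W^N}G_k(\mathbf W)$. On a probability space with filtration $(\mathcal F_k)$, fix an integer $\bar\kappa\ge0$ and an $\mathcal F_{\bar\kappa}$-measurable $\mathbf W_{\bar\kappa}\in\mathcal W^N$, and define for $k\ge\bar\kappa$ $$\mathbf W_{k+1}=\Pi^N\big[\mathbf W_k-\eta_k\nabla G_k(\mathbf W_k)+\gamma_k\boldsymbol\epsilon_k^{(1)}-\eta_k\boldsymbol\epsilon_k^{(2)}\big],$$ where $\boldsymbol\epsilon_k^{(1)},\boldsymbol\epsilon_k^{(2)}\in\mathbb R^{Nd}$ are $\mathcal F_{k+1}$-measurable with $\mathbb E[\boldsymbol\epsilon_k^{(1)}|\mathcal F_k]=\mathbb E[\boldsymbol\epsilon_k^{(2)}|\mathcal F_k]=\mathbf 0$, $\mathbb E[\langle\boldsymbol\epsilon_k^{(1)},\boldsymbol\epsilon_k^{(2)}\rangle|\mathcal F_k]=0$, and $\frac1N\mathbb E[\|\boldsymbol\epsilon_k^{(1)}\|^2|\mathcal F_k]\le\Sigma^{(1)}$, $\frac1N\mathbb E[\|\boldsymbol\epsilon_k^{(2)}\|^2|\mathcal F_k]\le\Sigma^{(2)}$ for constants $\Sigma^{(1)},\Sigma^{(2)}\ge0$. The noise-free dynamics are $\overline{\mathbf W}_{\bar\kappa}=\mathbf W_{\bar\kappa}$, $\overline{\mathbf W}_{k+1}=\Pi^N[\overline{\mathbf W}_k-\eta_k\nabla G_k(\overline{\mathbf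 W}_k)]$ for $k\ge\bar\kappa$. For a random vector $\mathbf a$, $\|\mathbf a\|_{\mathbb E}\triangleq\sqrt{\mathbb E\|\mathbf a\|^2}$. *)

(* Defs.v *)
From HB Require Import structures.
From mathcomp Require Import all_boot all_order all_algebra.
From mathcomp Require Import all_classical all_reals all_analysis.
Set Implicit Arguments. Unset Strict Implicit. Unset Printing Implicit Defensive.
Import Order.TTheory GRing.Theory Num.Theory numFieldNormedType.Exports.
Local Open Scope classical_set_scope.
Local Open Scope ring_scope.

Section Defs.
Variable R : realType.

Definition dotr d (u v : 'rV[R]_d) : R := \sum_(j < d) u ord0 j * v ord0 j.
Definition nrm d (u : 'rV[R]_d) : R := Num.sqrt (dotr u u).

(* A stacked vector W = [w_1; ...; w_N] in R^{Nd} is represented as the N x d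
   matrix whose i-th row is w_i.  The Euclidean norm on R^{Nd} is then the
   Frobenius norm. *)
Definition frob2 N d (X : 'M[R]_(N, d)) : R := \sum_(i < N) \sum_(j < d) X i j ^+ 2.
Definition frobn N d (X : 'M[R]_(N, d)) : R := Num.sqrt (frob2 X).

Definition is_gradient d (f : 'rV[R]_d -> R) (g : 'rV[R]_d -> 'rV[R]_d) :=
  forall w, differentiable f w /\ forall h, 'd f w h = dotr (g w) h.

Definition strongly_convex d (mu : R) (f : 'rV[R]_d -> R) :=
  forall x y (t : R), 0 <= t <= 1 ->
    f (t *: x + (1 - t) *: y) <=
      t * f x + (1 - t) * f y - mu / 2 * t * (1 - t) * nrm (x - y) ^+ 2.

Definition lipschitz_grad d (L : R) (g : 'rV[R]_d -> 'rV[R]_d) :=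
  forall x y, nrm (g x - g y) <= L * nrm (x - y).

Definition bdry d (S : set 'rV[R]_d) := closure S `\` interior S.

(* zeta = min over bd(W) of ||w - w*|| ; dm(W) = max_{w,w' in W} ||w - w'||
   (both attained; min = inf and max = sup) *)
Definition zeta_of d (S : set 'rV[R]_d) (ws : 'rV[R]_d) : R :=
  inf [set nrm (w - ws) | w in bdry S].
Definition diam d (S : set 'rV[R]_d) : R :=
  sup [set r | exists w w', [/\ S w, S w' & r = nrm (w - w')]].

Definition nabla_star N d (g : 'I_N -> 'rV[R]_d -> 'rV[R]_d) (ws : 'rV[R]_d) : R :=
  \big[Num.max/0]_(i < N) nrm (g i ws).

Definition setN N d (S : set 'rV[R]_d) : set 'M[R]_(N, d) :=
  [set X | forall i, S (row i X)].

(* Euclidean projection onto a set (well defined for closed convex nonempty S) *)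
Definition proj N d (S : set 'M[R]_(N, d)) (X : 'M[R]_(N, d)) : 'M[R]_(N, d) :=
  xget X [set P | S P /\ forall Q, S Q -> frobn (X - P) <= frobn (X - Q)].

(* argmin of a function over a set (unique minimizer in our use) *)
Definition argmin_on N d (S : set 'M[R]_(N, d)) (G : 'M[R]_(N, d) -> R) :=
  xget 0 [set P | S P /\ forall Q, S Q -> G P <= G Q].

Definition fsum N d (f : 'I_N -> 'rV[R]_d -> R) (X : 'M[R]_(N, d)) : R :=
  \sum_(i < N) f i (row i X).
Definition gradf N d (g : 'I_N -> 'rV[R]_d -> 'rV[R]_d) (X : 'M[R]_(N, d)) :=
  \matrix_(i < N, j < d) g i (row i X) ord0 j.

(* W^T (Lap (x) I_d) W *)
Definition quadL N d (Lap : 'M[R]_N) (X : 'M[R]_(N, d)) : R :=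
  \sum_(i < N) \sum_(j < N) Lap i j * dotr (row i X) (row j X).

Definition Gk N d (f : 'I_N -> 'rV[R]_d -> R) (Lap : 'M[R]_N)
  (eta gamma : nat -> R) (k : nat) (X : 'M[R]_(N, d)) : R :=
  fsum f X + gamma k / (2 * eta k) * quadL Lap X.

(* grad G_k(W) = grad f(W) + (gamma_k/eta_k) (L (x) I_d) W   (L symmetric) *)
Definition gradGk N d (g : 'I_N -> 'rV[R]_d -> 'rV[R]_d) (Lap : 'M[R]_N)
  (eta gamma : nat -> R) (k : nat) (X : 'M[R]_(N, d)) : 'M[R]_(N, d) :=
  gradf g X + (gamma k / eta k) *: (Lap *m X).

Definition Wstar_k N d (S : set 'rV[R]_d) (f : 'I_N -> 'rV[R]_d -> R)
  (Lap : 'M[R]_N) (eta gamma : nat -> R) (k : nat) : 'M[R]_(N, d) :=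
  argmin_on (@setN N d S) (Gk f Lap eta gamma k).

(* noisy iterates: Witer n = W_{kbar + n} *)
Fixpoint Witer N d (S : set 'rV[R]_d) (g : 'I_N -> 'rV[R]_d -> 'rV[R]_d)
  (Lap : 'M[R]_N) (eta gamma : nat -> R) (kbar : nat) (W0 : 'M[R]_(N, d))
  (e1 e2 : nat -> 'M[R]_(N, d)) (n : nat) : 'M[R]_(N, d) :=
  match n with
  | 0 => W0
  | n'.+1 =>
    let k := (kbar + n')%N in
    let X := Witer S g Lap eta gamma kbar W0 e1 e2 n' in
    proj (@setN N d S) (X - eta k *: gradGk g Lap eta gamma k X
                       + gamma k *: e1 k - eta k *: e2 k)
  end.

(* W_k for k >= kbar (pointwise in the sample) *)
Definition Wk N d S g Lap eta gamma kbar (W0 : 'M[R]_(N, d)) e1 e2 (k : nat) :=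
  @Witer N d S g Lap eta gamma kbar W0 e1 e2 (k - kbar)%N.

Definition Wbark N d S g Lap eta gamma kbar (W0 : 'M[R]_(N, d)) (k : nat) :=
  @Witer N d S g Lap eta gamma kbar W0 (fun _ => 0) (fun _ => 0) (k - kbar)%N.

(* P_{tk} = prod_{j=t+1}^{k-1} (1 - mu eta_j), written in terms of s = t+1 *)
Definition Pprod (mu : R) (eta : nat -> R) (s k : nat) : R :=
  \prod_(s <= j < k) (1 - mu * eta j).

Definition esqrt (x : \bar R) : \bar R :=
  match x with
  | EFin r => (Num.sqrt r)%:E
  | +oo%E => +oo%E
  | -oo%E => 0%E
  end.

End Defs.

Section Prob.
Context (R : realType) (dsp : measure_display) (Om : measurableType dsp)
        (P : probability Om R).

Definition Gmeas (G : set (set Om)) (Y : Om -> R) :=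
  forall B : set R, measurable B -> G (Y @^-1` B).
Definition Gmeas_mx N d (G : set (set Om)) (Y : Om -> 'M[R]_(N, d)) :=
  forall i j, Gmeas G (fun w => Y w i j).

Definition is_cond_exp (G : set (set Om)) (X Y : Om -> R) :=
  [/\ Gmeas G Y, P.-integrable setT (EFin \o X), P.-integrable setT (EFin \o Y) &
      forall A, G A -> (\int[P]_(w in A) (X w)%:E = \int[P]_(w in A) (Y w)%:E)%E].

Definition enorm N d (X : Om -> 'M[R]_(N, d)) : \bar R :=
  esqrt (\int[P]_w (frob2 (X w))%:E)%E.

End Prob.

(* Main.v *)
Require Import Defs.
From HB Require Import structures.
From mathcomp Require Import all_boot all_order all_algebra.
From mathcomp Require Import all_classical all_reals all_analysis.
From mathcomp Require Import complex spectral sesquilinear measurable_realfun.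
From mathcomp Require Import zify ring lra.
Import Order.TTheory GRing.Theory Num.Theory numFieldNormedType.Exports.
Set Implicit Arguments. Unset Strict Implicit. Unset Printing Implicit Defensive.
Local Open Scope classical_set_scope.
Local Open Scope ring_scope.

(* Write c = gamma_k / eta_k, D = X - X', and let Delta be the difference of the
   gradients of f at X and X'.  If Delta + c Lap (D + Y) = 0, pairing with D + Y
   and using Lap >= 0 gives <Delta, D> <= - <Delta, Y>, hence |D| <= (L / mu) |Y|
   by strong monotonicity and Lipschitz continuity.  With X' = 1 (x) w* and Y the
   solution of c Lap Y = grad f (X'), which exists in the zero-sum subspace with
   |Y| <= |grad f (X')| / (c rho_2), this bounds the distance to consensus of the
   unconstrained minimizer of G_k; by (C2) and the definition of zeta that
   minimizer lies in W^N, so it is W*_k.  The same argument applied to two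
   successive penalties bounds |W*_{k+1} - W*_k|.

   By cocoercivity and (C1) a gradient step on G_k contracts by 1 - mu eta_k, and
   projections are nonexpansive, so the noise-free error obeys a linear recursion
   driven by the drift of W*_k.  For the noisy iterates, the gap of the gradient
   steps is bounded and F_k-measurable, so the cross terms with the noise have
   zero mean and the mean squared gap obeys a linear recursion as well. *)

(** * The Frobenius inner product *)

Section FrobeniusInnerProduct.
Variables (R : realType) (N d : nat).
Implicit Types X Y Z : 'M[R]_(N, d).

(** The penalty controls nothing along consensus directions, since Lap kills 1 (x) w; there only the
    strong convexity of f acts. Testing with D + Y rather than D uses just the sign of <V, Lap V>,
    so c enters the bound only through Y. This is the origin of the scale eta_k / gamma_k = 1 / c in
    the last two estimates.

    (C2) is calibrated so that sqrt N times the third bound of the theorem is at most zeta. Hence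
    W*_k is a zero of grad G_k and not just a constrained minimizer: it is a fixed point of the
    projected step, and consecutive minimizers are compared through equations instead of variational
    inequalities.

    Boundedness of W also serves the random part: the products of noise and iterates are integrable
    because the iterates are bounded. Measurability cannot be read off formulas, as the projection
    and the gradients have none; it follows from their Lipschitz dependence on the point. *)

Definition mdot X Y : R := \tr (X^T *m Y).

Lemma mdotE X Y : mdot X Y = \sum_i \sum_j X i j * Y i j.
Proof.
rewrite /mdot /mxtrace exchange_big /=; apply: eq_bigr => j _.
by rewrite mxE; apply: eq_bigr => i _; rewrite mxE.
Qed.

Lemma mdotC X Y : mdot X Y = mdot Y X.
Proof. by rewrite /mdot -mxtrace_tr trmx_mul trmxK. Qed.

Lemma mdotDl X Y Z : mdot (X + Y) Z = mdot X Z + mdot Y Z.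
Proof. by rewrite /mdot linearD /= mulmxDl linearD. Qed.

Lemma mdotNl X Z : mdot (- X) Z = - mdot X Z.
Proof. by rewrite /mdot linearN /= mulNmx linearN. Qed.

Lemma mdotZl a X Z : mdot (a *: X) Z = a * mdot X Z.
Proof. by rewrite /mdot linearZ /= -scalemxAl linearZ. Qed.

Lemma mdotBl X Y Z : mdot (X - Y) Z = mdot X Z - mdot Y Z.
Proof. by rewrite mdotDl mdotNl. Qed.

Lemma mdotDr X Y Z : mdot Z (X + Y) = mdot Z X + mdot Z Y.
Proof. by rewrite mdotC mdotDl !(mdotC Z). Qed.

Lemma mdotNr X Z : mdot Z (- X) = - mdot Z X.
Proof. by rewrite mdotC mdotNl mdotC. Qed.

Lemma mdotZr a X Z : mdot Z (a *: X) = a * mdot Z X.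
Proof. by rewrite mdotC mdotZl mdotC. Qed.

Lemma mdotBr X Y Z : mdot Z (X - Y) = mdot Z X - mdot Z Y.
Proof. by rewrite mdotDr mdotNr. Qed.

Definition mdot_linE :=
  (mdotDl, mdotDr, mdotNl, mdotNr, mdotZl, mdotZr).

Lemma mdot0l X : mdot 0 X = 0.
Proof. by rewrite -(scale0r X) mdotZl mul0r. Qed.

Lemma mdot0r X : mdot X 0 = 0.
Proof. by rewrite mdotC mdot0l. Qed.

Lemma frob2E X : frob2 X = mdot X X.
Proof. by rewrite mdotE. Qed.

Lemma frob2_ge0 X : 0 <= frob2 X.
Proof. by do 2 (apply: sumr_ge0 => ? _); rewrite sqr_ge0. Qed.

Lemma frob2_eq0 X : (frob2 X == 0) = (X == 0).
Proof.
apply/eqP/eqP => [X0|->]; last by rewrite frob2E mdot0l.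
apply/matrixP => i j; rewrite mxE; apply/eqP; rewrite -sqrf_eq0.
have S0 k : 0 <= \sum_l X k l ^+ 2 by apply: sumr_ge0 => l _; rewrite sqr_ge0.
have /eqP : \sum_l X i l ^+ 2 = 0 by apply: (psumr_eq0P _ X0).
rewrite psumr_eq0; last by move=> l _; rewrite sqr_ge0.
by move=> /allP /(_ j); rewrite mem_index_enum => /(_ isT).
Qed.

Lemma frob2Z a X : frob2 (a *: X) = a ^+ 2 * frob2 X.
Proof. by rewrite !frob2E !mdot_linE mulrA. Qed.

Lemma frob2N X : frob2 (- X) = frob2 X.
Proof. by rewrite !frob2E !mdot_linE opprK. Qed.

Lemma frobn_ge0 X : 0 <= frobn X. Proof. exact: sqrtr_ge0. Qed.

Lemma sqr_frobn X : frobn X ^+ 2 = mdot X X.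
Proof. by rewrite sqr_sqrtr ?frob2_ge0 // frob2E. Qed.

Lemma frobn_eq0 X : (frobn X == 0) = (X == 0).
Proof. by rewrite /frobn sqrtr_eq0 -frob2_eq0 eq_le frob2_ge0 andbT. Qed.

Lemma frobnN X : frobn (- X) = frobn X.
Proof. by rewrite /frobn frob2N. Qed.

Lemma frobnB X Y : frobn (X - Y) = frobn (Y - X).
Proof. by rewrite -frobnN opprB. Qed.

Lemma frobn0 : frobn (0 : 'M[R]_(N, d)) = 0.
Proof. by apply/eqP; rewrite frobn_eq0. Qed.

Lemma frobnZ a X : frobn (a *: X) = `|a| * frobn X.
Proof. by rewrite /frobn frob2Z sqrtrM ?sqr_ge0 // sqrtr_sqr. Qed.

Lemma ler_frobn X (a : R) : 0 <= a -> (frobn X <= a) = (mdot X X <= a ^+ 2).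
Proof. by move=> a0; rewrite -sqr_frobn ler_sqr ?nnegrE ?frobn_ge0. Qed.

Lemma ler_frobn2 X Y : (frobn X <= frobn Y) = (mdot X X <= mdot Y Y).
Proof. by rewrite ler_frobn ?frobn_ge0 // sqr_frobn. Qed.

(** Cauchy-Schwarz, from the squared norm of [frobn Y *: X - frobn X *: Y]. *)
Lemma mdot_le X Y : mdot X Y <= frobn X * frobn Y.
Proof.
have [->|X0] := eqVneq X 0; first by rewrite mdot0l frobn0 mul0r.
have [->|Y0] := eqVneq Y 0; first by rewrite mdot0r frobn0 mulr0.
have x0 : 0 < frobn X by rewrite lt_def frobn_ge0 frobn_eq0 X0.
have y0 : 0 < frobn Y by rewrite lt_def frobn_ge0 frobn_eq0 Y0.
have := frob2_ge0 (frobn Y *: X - frobn X *: Y).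
rewrite frob2E !mdot_linE -!sqr_frobn (mdotC Y X) => h.
have xy0 : 0 < frobn X * frobn Y by rewrite mulr_gt0.
rewrite -(ler_pM2l xy0); lra.
Qed.

Lemma ler_frobnD X Y : frobn (X + Y) <= frobn X + frobn Y.
Proof.
rewrite ler_frobn ?addr_ge0 ?frobn_ge0 // !mdot_linE (mdotC Y X).
by rewrite sqrrD !sqr_frobn; have := mdot_le X Y; lra.
Qed.

Lemma ler_frobn_dist X Y Z : frobn (X - Z) <= frobn (X - Y) + frobn (Y - Z).
Proof. by rewrite (le_trans _ (ler_frobnD _ _)) // addrA subrK. Qed.

End FrobeniusInnerProduct.

Arguments mdot {R N d}.

(** * Spectral bounds for the Laplacian *)

Section Spectral.
Local Open Scope sesquilinear_scope.
Variables (R : realType) (n : nat).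
Local Notation C := R[i].
Local Notation cplx := (map_mx (real_complex R)).

Definition cmod2 (z : C) : R := complex.Re z ^+ 2 + complex.Im z ^+ 2.

Lemma cmod2E (z : C) : (cmod2 z)%:C%C = z^*%C * z.
Proof. by rewrite /cmod2 add_Re2_Im2 sqr_normc mulrC. Qed.

Lemma cmod2_eq0 (z : C) : cmod2 z = 0 -> z = 0.
Proof.
case: z => a b; rewrite /cmod2 /= => /eqP.
by rewrite paddr_eq0 ?sqr_ge0 // !sqrf_eq0 => /andP[/eqP-> /eqP->].
Qed.

(** With weights 1 and with the eigenvalues as weights, this yields the spectral sums for the
    squared norm and for the quadratic form. *)
Lemma tr_diag_weight d (Z : 'M[C]_(n, d)) (r : 'I_n -> R) :
  \tr (Z ^t* *m (diag_mx (\row_i (r i)%:C%C) *m Z))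
    = (\sum_i r i * \sum_j cmod2 (Z i j))%:C%C.
Proof.
have -> : (\sum_i r i * \sum_j cmod2 (Z i j)) =
    \sum_j \sum_i r i * cmod2 (Z i j).
  by rewrite exchange_big /=; apply: eq_bigr => i _; rewrite mulr_sumr.
rewrite /mxtrace (rmorph_sum (real_complex R)) /=; apply: eq_bigr => j _.
rewrite mxE (rmorph_sum (real_complex R)) /=; apply: eq_bigr => i _.
by rewrite mul_diag_mx !mxE [RHS]rmorphM /= cmod2E mulrCA.
Qed.

Lemma unitary_isometry m d (Q : 'M[C]_n) (Y : 'M[C]_(n, m)) (Z : 'M[C]_(n, d)) :
  Q ^t* *m Q = 1%:M -> (Q *m Y) ^t* *m (Q *m Z) = Y ^t* *m Z.
Proof.
by move=> QQ; rewrite trmx_mul map_mxM mulmxA -(mulmxA _ (Q ^t*)) QQ mulmx1.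
Qed.

Lemma cplx_conj m d (X : 'M[R]_(m, d)) : (cplx X) ^t* = cplx X^T.
Proof. by apply/matrixP => i j; rewrite !mxE; exact: conjc_real. Qed.

Lemma cplx_mdot d (X Y : 'M[R]_(n, d)) :
  (mdot X Y)%:C%C = \tr ((cplx X) ^t* *m cplx Y).
Proof. by rewrite /mdot -(trace_map_mx (real_complex R)) map_mxM cplx_conj. Qed.

Variable Lap : 'M[R]_n.
Hypothesis Lsym : Lap^T = Lap.

Lemma mdot_symL d (X Y : 'M[R]_(n, d)) : mdot (Lap *m X) Y = mdot X (Lap *m Y).
Proof. by rewrite /mdot trmx_mul Lsym mulmxA. Qed.

Lemma cplx_herm : (cplx Lap) \is hermsymmx.
Proof.
apply: realsym_hermsym; last first.
  by apply/mxOverP => i j; rewrite mxE; apply/complex_realP; eexists.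
apply/is_hermitianmxP; rewrite expr0 scale1r; apply/matrixP => i j.
by rewrite !mxE -[in LHS]Lsym mxE.
Qed.

(* An opaque package: spectralmx would unfold during matrix rewriting. *)
Lemma spectral_basis : {Ps : 'M[C]_n * ('I_n -> R) | Ps.1 \is unitarymx /\
  cplx Lap = Ps.1 ^t* *m (diag_mx (\row_i (Ps.2 i)%:C%C) *m Ps.1)}.
Proof.
exists (spectralmx (cplx Lap),
        fun i => complex.Re (spectral_diag (cplx Lap) ord0 i)).
split=> /=; first exact: spectral_unitarymx.
rewrite -invmx_unitary ?spectral_unitarymx // mulmxA.
have -> : \row_i (complex.Re (spectral_diag (cplx Lap) ord0 i))%:C%C =
          spectral_diag (cplx Lap).
  apply/rowP => i; rewrite mxE RRe_real //.
  by have /mxOverP := hermitian_spectral_diag_real cplx_herm; apply.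
by apply/orthomx_spectralP; apply: hermitian_normalmx; exact: cplx_herm.
Qed.

Definition spectrum : 'I_n -> R := (sval spectral_basis).2.
Local Notation P := (sval spectral_basis).1.
Local Notation s := spectrum.
Local Notation D := (diag_mx (\row_i (s i)%:C%C)).

Let Punit : P \is unitarymx. Proof. by case: (svalP spectral_basis). Qed.

Let LapE : cplx Lap = P ^t* *m (D *m P).
Proof. by case: (svalP spectral_basis). Qed.

Let PPt : P *m P ^t* = 1%:M. Proof. exact/unitarymxP. Qed.

Let PtP : P ^t* *m P = 1%:M.
Proof. by rewrite -invmx_unitary // mulVmx // unitarymx_unit. Qed.

(** Similar matrices share their characteristic polynomial; this is the only link between the
    diagonalization and the given list rho. *)
Lemma spectral_char_poly : char_poly Lap = \prod_i ('X - (s i)%:P).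
Proof.
apply: (map_poly_inj (real_complex R)); rewrite map_char_poly map_prod_XsubC.
move: LapE PtP PPt; set Q := P; move: Q => Q LE QQ QQ'.
rewrite {1}/char_poly.
have -> : char_poly_mx (cplx Lap) =
    map_mx (@polyC C) (Q ^t*) *m (char_poly_mx D *m map_mx (@polyC C) Q).
  rewrite /char_poly_mx mulmxBl mulmxBr -!map_mxM -LE.
  by rewrite -scalar_mxC mulmxA -map_mxM QQ map_mx1 mul1mx.
rewrite 2!det_mulmx mulrCA -det_mulmx -map_mxM QQ.
rewrite map_mx1 det1 mulr1 -/(char_poly _) char_poly_trig ?diag_mx_is_trig //.
by apply: eq_bigr => i _; rewrite !mxE eqxx mulr1n.
Qed.

(** The squared length of the component of X along the i-th eigenvector, summed over the columns; it
    is real although the eigenbasis is complex. *)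
Definition spectral_weight d (X : 'M[R]_(n, d)) i : R :=
  \sum_j cmod2 ((P *m cplx X) i j).

Lemma spectral_weight_ge0 d (X : 'M[R]_(n, d)) i : 0 <= spectral_weight X i.
Proof. by apply: sumr_ge0 => j _; rewrite addr_ge0 ?sqr_ge0. Qed.

Let weight_trace d (X : 'M[R]_(n, d)) (r : 'I_n -> R) :
  (\sum_i r i * spectral_weight X i)%:C%C =
  \tr ((P *m cplx X) ^t* *m (diag_mx (\row_i (r i)%:C%C) *m (P *m cplx X))).
Proof. by rewrite tr_diag_weight. Qed.

Let PLap d (X : 'M[R]_(n, d)) : P *m cplx (Lap *m X) = D *m (P *m cplx X).
Proof.
rewrite map_mxM; move: LapE PPt; set r := \row_i _; set Q := P.
by move: Q r => Q r -> QQ; rewrite !mulmxA QQ mul1mx.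
Qed.

Lemma spectral_frob2 d (X : 'M[R]_(n, d)) :
  mdot X X = \sum_i spectral_weight X i.
Proof.
apply: complexI; under eq_bigr do rewrite -[spectral_weight _ _]mul1r.
rewrite (weight_trace _ (fun=> 1)) cplx_mdot.
have -> : diag_mx (\row_(i < n) 1%:C%C) = 1%:M :> 'M[C]_n.
  by rewrite -diag_const_mx; congr diag_mx; apply/rowP => i; rewrite !mxE.
by rewrite mul1mx unitary_isometry.
Qed.

Lemma spectral_quad d (X : 'M[R]_(n, d)) :
  mdot X (Lap *m X) = \sum_i s i * spectral_weight X i.
Proof.
by apply: complexI; rewrite weight_trace -PLap unitary_isometry // cplx_mdot.
Qed.

Lemma spectral_weight_lap d (X : 'M[R]_(n, d)) i :
  spectral_weight (Lap *m X) i = s i ^+ 2 * spectral_weight X i.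
Proof.
rewrite /spectral_weight mulr_sumr; apply: eq_bigr => j _.
rewrite PLap mul_diag_mx !mxE /cmod2; case: (\sum_ _ _) => a b /=.
by rewrite !mul0r subr0 addr0; ring.
Qed.

(** In the eigenbasis u has the single coordinate i, so [u^T *m X = 0] says that the conjugate of
    this coordinate times the i-th row of X vanishes. *)
Lemma spectral_weight_orth d (u : 'cV[R]_n) (X : 'M[R]_(n, d)) i :
  u^T *m X = 0 -> (forall k, k != i -> spectral_weight u k = 0) ->
  spectral_weight u i != 0 -> spectral_weight X i = 0.
Proof.
move=> uX u0 ui.
have h : (P *m cplx u) ^t* *m (P *m cplx X) = 0.
  by rewrite unitary_isometry // cplx_conj -map_mxM uX map_mx0.
have {u0} : forall k, k != i -> (P *m cplx u) k ord0 = 0.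
  by move=> k /u0; rewrite /spectral_weight big_ord1 => /cmod2_eq0.
have {ui} : (P *m cplx u) i ord0 != 0.
  apply: contraNneq ui => ui; rewrite /spectral_weight big_ord1 ui.
  by rewrite /cmod2 /= expr0n addr0.
rewrite /spectral_weight; move: (P *m cplx u) (P *m cplx X) h => U Z h ui u0.
apply: big1 => j _; have /matrixP/(_ ord0 j) := h.
rewrite !mxE (bigD1 i) //= big1 ?addr0; last first.
  by move=> k ki; rewrite !mxE u0 // conjC0 mul0r.
move=> /eqP; rewrite mulf_eq0 !mxE conjC_eq0 (negPf ui) => /eqP->.
by rewrite /cmod2 /= expr0n addr0.
Qed.

End Spectral.

(** * Eigenvalues, kernel and solvability for the Laplacian *)

Section Laplacian.
Variables (R : realType) (N : nat) (Lap : 'M[R]_N).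
Hypothesis HN : (2 <= N)%N.
Hypothesis Lsym : Lap^T = Lap.
Hypothesis L1 : Lap *m const_mx 1 = 0 :> 'cV[R]_N.
Variable rho : nat -> R.
Hypothesis Hchar : char_poly Lap = \prod_(1 <= i < N.+1) ('X - (rho i)%:P).
Hypothesis Hsort : forall i j : nat,
  (1 <= i)%N -> (i <= j)%N -> (j <= N)%N -> rho i <= rho j.
Hypothesis Hrho2 : 0 < rho 2%N.

Local Notation s := (spectrum Lsym).

Lemma perm_spectrum :
  perm_eq [seq s i | i <- enum 'I_N] [seq rho i | i <- index_iota 1 N.+1].
Proof.
apply: prod_XsubC_eq; rewrite [RHS]big_map -Hchar (spectral_char_poly Lsym).
by rewrite [LHS]big_map big_enum.
Qed.

Let one : 'cV[R]_N := const_mx 1.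

Let w1 i := spectral_weight Lsym one i.

(** Lap kills 1_N and scales the weight at i by s_i^2, so 1_N has weight only where s_i = 0. *)
Let sw0 i : s i * w1 i = 0.
Proof.
have : spectral_weight Lsym (Lap *m one) i = 0.
  rewrite L1; apply: (psumr_eq0P (P := predT) (F := spectral_weight Lsym (0 : 'cV_N))) => //.
    by move=> k _; exact: spectral_weight_ge0.
  by rewrite -(spectral_frob2 Lsym) mdot0l.
rewrite spectral_weight_lap => /eqP.
by rewrite mulf_eq0 sqrf_eq0 => /orP[]/eqP sw; rewrite /w1 sw (mul0r, mulr0).
Qed.

Let rho_gt0 i : (2 <= i <= N)%N -> rho 2%N <= rho i.
Proof. by move=> /andP[i2 iN]; apply: Hsort. Qed.

Let s_rho i : exists2 k, (1 <= k <= N)%N & s i = rho k.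
Proof.
have : s i \in [seq s i | i <- enum 'I_N] by rewrite map_f ?mem_enum.
by rewrite (perm_mem perm_spectrum) => /mapP[k]; rewrite mem_index_iota => ? ->;
  exists k.
Qed.

Lemma spectrum_le i : s i <= rho N.
Proof. by have [k /andP[k1 kN] ->] := s_rho i; apply: Hsort. Qed.

Let zero_index : exists2 i0, w1 i0 != 0 & s i0 = 0.
Proof.
have [i0 wi0] : exists i0, w1 i0 != 0.
  apply/existsP; apply: contraT; rewrite negb_exists => /forallP h.
  have : mdot one one = 0.
    by rewrite (spectral_frob2 Lsym) big1 // => i _; apply/eqP/negPn/h.
  rewrite mdotE; under eq_bigr do rewrite big_ord1 !mxE mulr1.
  rewrite sumr_const card_ord => /eqP; rewrite pnatr_eq0 => /eqP N0.
  by move: HN; rewrite N0.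
by exists i0 => //; have /eqP := sw0 i0; rewrite mulf_eq0 (negPf wi0) orbF => /eqP.
Qed.

(** 0 is an eigenvalue, hence some rho k, and [Hrho2] with the ordering makes rho k positive for
    every k >= 2. *)
Let rho1 : rho 1%N = 0.
Proof.
have [i0 _ si0] := zero_index; have [k /andP[k1 kN] rk] := s_rho i0.
have [<-|k2] := eqVneq k 1%N; first by rewrite -rk.
have : rho 2%N <= rho k by rewrite rho_gt0 // kN andbT ltn_neqAle eq_sym k2.
by rewrite -rk si0 leNgt Hrho2.
Qed.

Lemma spectrum_ge0 i : 0 <= s i.
Proof.
have [k /andP[k1 kN] ->] := s_rho i.
by rewrite -rho1 Hsort.
Qed.

(** Simplicity of the eigenvalue 0 makes 1_N span the kernel, so a zero-sum matrix has no kernel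
    component at all. *)
Let count0 : count_mem 0 [seq s i | i <- enum 'I_N] = 1%N.
Proof.
(* Writing N as (N - 2) + 2 exposes the entries rho 1 and rho 2; the remaining list starts at index
   3. *)
rewrite (permP perm_spectrum) /index_iota subn1 /= -[N in iota _ N](subnK HN).
rewrite addn2 /= rho1 eqxx gt_eqF // add0n.
set r := map _ _; suff -> : count_mem 0 r = 0%N by [].
apply/count_memPn/negP => /mapP[k].
rewrite mem_iota => /andP[k3 kN] r0.
have : rho 2%N <= rho k by rewrite rho_gt0 // (ltnW k3) /=; lia.
by rewrite -r0 leNgt Hrho2.
Qed.

Lemma spectrum_gap i0 i : s i0 = 0 -> i != i0 -> rho 2%N <= s i.
Proof.
move=> si0 ii0; have si : s i != 0.
  apply/negP => /eqP si; have := count0.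
  rewrite count_map -sum1_count big_enum_cond /=.
  by rewrite (bigD1 i0) /= ?si0 // (bigD1 i) //= si eqxx ii0.
have [k /andP[k1 kN] rk] := s_rho i; rewrite rk rho_gt0 // kN andbT ltn_neqAle k1.
by rewrite andbT; apply: contraNneq si => k1'; rewrite rk -k1' rho1.
Qed.

Section Columns.
Variable d : nat.
Implicit Types X Y : 'M[R]_(N, d).

Lemma lap_quad_ge0 X : 0 <= mdot X (Lap *m X).
Proof.
rewrite (spectral_quad Lsym); apply: sumr_ge0 => i _.
by rewrite mulr_ge0 ?spectral_weight_ge0 ?spectrum_ge0.
Qed.

Lemma lap_quad_le X : mdot X (Lap *m X) <= rho N * mdot X X.
Proof.
rewrite spectral_quad (spectral_frob2 Lsym) mulr_sumr; apply: ler_sum => i _.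
by rewrite ler_wpM2r ?spectral_weight_ge0 ?spectrum_le.
Qed.

Definition zero_sum X := one^T *m X = 0.

Lemma zero_sumE X : zero_sum X <-> forall j, \sum_i X i j = 0.
Proof.
have E j : (one^T *m X) ord0 j = \sum_i X i j.
  by rewrite mxE; apply: eq_bigr => i _; rewrite !mxE mul1r.
split=> [X0 j|X0]; first by rewrite -E X0 mxE.
by apply/matrixP => i j; rewrite ord1 E X0 mxE.
Qed.

Lemma zero_sum_lap X : zero_sum (Lap *m X).
Proof. by rewrite /zero_sum mulmxA -{1}Lsym -trmx_mul L1 trmx0 mul0mx. Qed.

(** The weight of X at i0 vanishes and s_i >= rho_2 elsewhere, so the two spectral sums compare term
    by term. *)
Lemma lap_gap X : zero_sum X -> rho 2%N * frobn X <= frobn (Lap *m X).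
Proof.
move=> X0; have [i0 wi0 si0] := zero_index.
rewrite -ler_sqr ?nnegrE ?mulr_ge0 ?frobn_ge0 ?(ltW Hrho2) //.
rewrite exprMn !sqr_frobn !(spectral_frob2 Lsym) mulr_sumr.
apply: ler_sum => i _; rewrite spectral_weight_lap.
 have [->|ii0] := eqVneq i i0.
  rewrite (spectral_weight_orth X0 _ wi0) ?mulr0 // => k ki0.
  have /eqP := sw0 k; rewrite mulf_eq0 => /orP[/eqP sk|/eqP//].
  by have := spectrum_gap si0 ki0; rewrite sk leNgt Hrho2.
rewrite ler_wpM2r ?spectral_weight_ge0 // ler_sqr ?nnegrE ?spectrum_ge0 ?(ltW Hrho2) //.
exact: spectrum_gap ii0.
Qed.

End Columns.

(** The matrix [Lap + one *m one^T] multiplies column sums by N and agrees with Lap on zero-sum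
    matrices. An element of its kernel is therefore zero-sum, and [lap_gap] makes it 0; its inverse
    solves the singular system. *)
Lemma lap_solve d (X : 'M[R]_(N, d)) :
  zero_sum X -> exists2 Y, zero_sum Y & Lap *m Y = X.
Proof.
move=> X0; pose M := Lap + one *m (one^T).
have sumM k (Z : 'M[R]_(N, k)) : one^T *m (M *m Z) = N%:R *: (one^T *m Z).
  have LT : one^T *m Lap = 0 by rewrite -{1}Lsym -trmx_mul L1 trmx0.
  rewrite mulmxA mulmxDr LT add0r mulmxA scalemxAl; congr (_ *m _).
  rewrite -mul_scalar_mx; congr (_ *m _); apply/matrixP => i j.
  rewrite !ord1 !mxE eqxx mulr1n; under eq_bigr do rewrite !mxE mulr1.
  by rewrite sumr_const card_ord.
have N0 : N%:R != 0 :> R by rewrite pnatr_eq0 -lt0n (leq_trans _ HN).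
have sumM0 k (Z : 'M[R]_(N, k)) : zero_sum (M *m Z) -> zero_sum Z /\ Lap *m Z = M *m Z.
  rewrite /zero_sum sumM => /eqP; rewrite scaler_eq0 (negPf N0) /= => /eqP Z0.
  by split=> //; rewrite mulmxDl -mulmxA Z0 mulmx0 addr0.
have Mu : M \in unitmx.
  rewrite -row_free_unit; apply: inj_row_free => v vM.
  have MT : (M^T)%R = M by rewrite linearD /= Lsym trmx_mul trmxK.
  have Mv : M *m v^T = 0 by rewrite -MT -trmx_mul vM trmx0.
  have [|v0 Lv] := sumM0 _ v^T; first by rewrite /zero_sum Mv mulmx0.
  have := lap_gap v0; rewrite Lv Mv frobn0 pmulr_rle0 // => v_le0.
  apply: trmx_inj; rewrite trmx0; apply/eqP; rewrite -frobn_eq0.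
  by rewrite eq_le v_le0 frobn_ge0.
have MY : M *m (invmx M *m X) = X by rewrite mulKVmx.
have [|Y0 LY] := sumM0 _ (invmx M *m X); first by rewrite MY.
by exists (invmx M *m X) => //; rewrite LY.
Qed.

End Laplacian.

(** * First-order bounds and minimizers *)

Section Gradient.
Variables (R : realType) (d : nat) (f : 'rV[R]_d -> R) (g : 'rV[R]_d -> 'rV[R]_d).
Hypothesis Hgrad : is_gradient f g.

Lemma dotrE (u v : 'rV[R]_d) : dotr u v = mdot u v.
Proof. by rewrite mdotE big_ord1. Qed.

Lemma nrmE (u : 'rV[R]_d) : nrm u = frobn u.
Proof. by rewrite /nrm dotrE -frob2E. Qed.

Lemma gradient_cvg (x v : 'rV[R]_d) :
  h^-1 * (f (h *: v + x) - f x) @[h --> 0^'] --> mdot (g x) v.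
Proof.
have [df dfE] := Hgrad x.
rewrite -dotrE -dfE -deriveE //; exact: diff_derivable.
Qed.

Lemma gradient_line (x v : 'rV[R]_d) (t : R) :
  is_derive t 1 (fun t => f (x + t *: v)) (mdot (g (x + t *: v)) v).
Proof.
have h := @gradient_cvg (x + t *: v) v.
have E : (fun h : R => h^-1 *: (((fun t => f (x + t *: v)) \o shift t) (h *: 1)
      - f (x + t *: v))) = (fun h => h^-1 * (f (h *: v + (x + t *: v)) - f (x + t *: v))).
  apply/funext => u /=; congr (_ * (f _ - _)).
  by rewrite scalerDl addrCA [u *: 1]mulr1.
split; first by rewrite /derivable E; apply/cvg_ex; exists (mdot (g (x + t *: v)) v).
by rewrite /derive E; exact/cvg_lim.
Qed.

(** Divide the strong convexity inequality on the segment by t and let t tend to 0 from the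
    right. *)
Lemma strongly_convex_grad (mu : R) (x y : 'rV[R]_d) : strongly_convex mu f ->
  f x + mdot (g x) (y - x) + mu / 2 * mdot (y - x) (y - x) <= f y.
Proof.
move=> Hsc; set v := y - x.
have h1 := cvg_dnbhs_at_right (@gradient_cvg x v).
have h2 : f y - f x - mu / 2 * (1 - t) * mdot v v @[t --> (0:R)^'+] -->
          f y - f x - mu / 2 * (1 - 0) * mdot v v.
  apply: cvg_at_right_filter; apply: cvgB; first exact: cvg_cst.
  apply: cvgM; last exact: cvg_cst.
  by apply: cvgM; [exact: cvg_cst|apply: cvgB; [exact: cvg_cst|exact: cvg_id]].
suff : mdot (g x) v <= f y - f x - mu / 2 * (1 - 0) * mdot v v by lra.
apply: (ler_cvg_to h1 h2); near=> t.
have t0 : 0 < t by near: t; exact: nbhs_right_gt.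
have t1 : t < 1 by near: t; exact: nbhs_right_lt.
rewrite mulrC ler_pdivrMr //.
have := Hsc y x t; rewrite (ltW t0) (ltW t1) => /(_ isT).
have -> : t *: y + (1 - t) *: x = t *: v + x.
  by rewrite /v scalerBr scalerBl scale1r addrA addrAC.
rewrite nrmE sqr_frobn -/v; lra.
Unshelve. all: by end_near.
Qed.

(** Apply the mean value theorem to phi(t) = f(x + t v) - a t - b t^2: its derivative at c is at
    most L c |v|^2 - 2 b c, and b = L / 2 |v|^2 makes this 0. *)
Lemma lipschitz_descent (L : R) (x y : 'rV[R]_d) : lipschitz_grad L g ->
  f y <= f x + mdot (g x) (y - x) + L / 2 * mdot (y - x) (y - x).
Proof.
move=> HL; have yE : y = x + (y - x) by rewrite addrC subrK.
move: (y - x) yE => v {y}->.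
pose a := mdot (g x) v; pose b := L / 2 * mdot v v.
pose q : R -> R := a \*: id + b \*: (id ^+ 2).
pose phi : R -> R := (fun t => f (x + t *: v)) - q.
have phiE t : phi t = f (x + t *: v) - (a * t + b * t ^+ 2) by [].
have dP (t : R) : is_derive t 1 phi (mdot (g (x + t *: v)) v - (a + b * (2 * t))).
  have hf := @gradient_line x v t.
  have h1 := is_derive_id t (1 : R).
  have hq := is_deriveD (is_deriveZ a h1) (is_deriveZ b (is_deriveX 2 h1)).
  have h2 : is_derive t 1 q (a + b * (2 * t)).
    by apply: (is_derive_eq hq); rewrite /GRing.scale /= !mulr1 expr1.
  exact: is_deriveB.
have phi_cont : {within `[0, 1], continuous phi}.
  apply: continuous_subspaceT => t; apply: differentiable_continuous.
  by apply/derivable1_diffP; case: (dP t).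
have [c] := MVT ltr01 (fun t _ => dP t) phi_cont.
rewrite in_itv /= => /andP[c0 c1].
have -> : phi 1 = f (x + v) - (a + b).
  by rewrite phiE scale1r expr1n !mulr1.
have -> : phi 0 = f x by rewrite phiE scale0r addr0 expr0n !mulr0 addr0 subr0.
move=> h.
suff : mdot (g (x + c *: v) - g x) v <= L * c * mdot v v.
  by rewrite mdotBl -/a; move: h; rewrite /b => h h'; lra.
apply: le_trans (mdot_le _ _) _; rewrite -sqr_frobn expr2 mulrA ler_wpM2r //.
  exact: frobn_ge0.
rewrite -nrmE; apply: le_trans (HL _ _) _.
by rewrite addrAC subrr add0r nrmE frobnZ gtr0_norm // mulrA.
Qed.

End Gradient.

(** * Quadratic models, optimality conditions and contraction of gradient steps *)

Section StronglyConvexSmooth.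
Variables (R : realType) (N d : nat).
Implicit Types X Y Z P Q : 'M[R]_(N, d).

(** Strong convexity and smoothness enter below only as lower and upper quadratic models, which
    remain available after adding the Laplacian penalty. *)
Definition lower_quad (m : R) (G : 'M[R]_(N, d) -> R) (dG : 'M[R]_(N, d) -> 'M[R]_(N, d)) :=
  forall X Y, G X + mdot (dG X) (Y - X) + m / 2 * mdot (Y - X) (Y - X) <= G Y.

Definition upper_quad (l : R) (G : 'M[R]_(N, d) -> R) (dG : 'M[R]_(N, d) -> 'M[R]_(N, d)) :=
  forall X Y, G Y <= G X + mdot (dG X) (Y - X) + l / 2 * mdot (Y - X) (Y - X).

Definition convex_mx (S : set 'M[R]_(N, d)) :=
  forall X Y (t : R), 0 <= t <= 1 -> S X -> S Y -> S (t *: X + (1 - t) *: Y).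

Definition minimizer (S : set 'M[R]_(N, d)) (G : 'M[R]_(N, d) -> R) P :=
  S P /\ forall Q, S Q -> G P <= G Q.

Variables (G : 'M[R]_(N, d) -> R) (dG : 'M[R]_(N, d) -> 'M[R]_(N, d)).

Lemma strong_monotone m : lower_quad m G dG -> forall X Y,
  m * mdot (X - Y) (X - Y) <= mdot (dG X - dG Y) (X - Y).
Proof.
move=> lo X Y; have := lo X Y; have := lo Y X.
rewrite -(opprB X Y); move: (X - Y) => V.
rewrite mdotBl !(mdotNr, mdotNl) opprK => *; lra.
Qed.

(** On the segment from P to Z the upper model gives 0 <= t v + t^2 (l / 2) q for t in [0, 1], which
    fails for a suitable t if v < 0. *)
Lemma minimizer_vi l (S : set 'M[R]_(N, d)) P Z : upper_quad l G dG -> convex_mx S ->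
  minimizer S G P -> S Z -> 0 <= mdot (dG P) (Z - P).
Proof.
move=> up cS [SP minP] SZ; rewrite leNgt; apply/negP => neg.
set v := mdot _ _ in neg; set q := mdot (Z - P) (Z - P).
have step (t : R) : 0 <= t <= 1 -> 0 <= t * v + t ^+ 2 * (l / 2 * q).
  move=> t01; have SQ := cS _ _ _ t01 SZ SP.
  have QE : t *: Z + (1 - t) *: P - P = t *: (Z - P).
    by apply/matrixP => i j; rewrite !mxE; ring.
  have := minP _ SQ; have := up P (t *: Z + (1 - t) *: P).
  by rewrite QE !mdotZr mdotZl -/v -/q => *; lra.
have s1 : 0 <= v + l / 2 * q by have := step 1; rewrite ler01 lexx => /(_ isT); lra.
have [q0|q0] := leP (l / 2 * q) 0; first by lra.
have [h|h] := leP (l / 2 * q) (- v / 2); first by lra.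
(* With this t the quadratic term cancels half of the linear one, leaving t v / 2 < 0; the cases
   above ensure 0 < t <= 1. *)
pose t := (- v / 2) / (l / 2 * q).
have t0 : 0 < t by rewrite divr_gt0 //; lra.
have t1 : t <= 1 by rewrite ler_pdivrMr // mul1r ltW.
have tE : t * (l / 2 * q) = - v / 2 by rewrite divfK // gt_eqF.
have := step t; rewrite (ltW t0) t1 => /(_ isT).
by rewrite expr2 -mulrA tE => ?; nra.
Qed.

Lemma minimizer_unique m (S : set 'M[R]_(N, d)) P Q :
  0 < m -> lower_quad m G dG -> (forall Z, S Z -> 0 <= mdot (dG P) (Z - P)) ->
  S Q -> G Q <= G P -> Q = P.
Proof.
move=> m0 lo vi SQ QP; have := lo P Q; have := vi _ SQ => h1 h2.
have h3 : 0 <= mdot (Q - P) (Q - P) by rewrite -frob2E frob2_ge0.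
have : mdot (Q - P) (Q - P) <= 0 by nra.
move=> h4; apply/eqP; rewrite -subr_eq0 -frob2_eq0 frob2E.
by rewrite eq_le h3 h4.
Qed.

Section Smooth.
Variables (m l : R).
Hypotheses (ml : m < l) (lo : lower_quad m G dG) (up : upper_quad l G dG).

(* G - m/2 |.|^2 is convex with (l - m)-Lipschitz gradient; minimizing its
   upper model at Y below its lower model at X gives cocoercivity. *)
Lemma half_cocoercive X Y D : D = dG Y - dG X - m *: (Y - X) ->
  G X + mdot (dG X) (Y - X) + m / 2 * mdot (Y - X) (Y - X)
    + (2 * (l - m))^-1 * mdot D D <= G Y.
Proof.
move=> DE; set k := (l - m)^-1.
have lm0 : l - m != 0 by rewrite subr_eq0 gt_eqF.
have := lo X (Y - k *: D); have := up Y (Y - k *: D).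
have -> : Y - k *: D - Y = - (k *: D) by rewrite addrC addKr.
have -> : Y - k *: D - X = (Y - X) - k *: D by rewrite addrAC.
have gE : mdot (dG Y) D = mdot (dG X) D + mdot D D + m * mdot (Y - X) D.
  by rewrite {3}DE !mdotBl mdotZl mdotBl; ring.
move: (Y - X) gE => V gE.
rewrite !(mdotBr, mdotBl, mdotNr, mdotNl, mdotZr, mdotZl) gE (mdotC D V) opprK.
set u := mdot V D; set w := mdot D D; set q := mdot V V => h1 h2.
have -> : (2 * (l - m))^-1 * w = k * w - (l - m) / 2 * (k * (k * w)).
  by rewrite /k; field.
lra.
Qed.

(** With V and D the differences of points and gradients, the claim reduces to e (|D|^2 - m^2 |V|^2)
    <= 2 (<V, D> - m |V|^2). Adding [half_cocoercive] in both directions bounds |D|^2 - m^2 |V|^2 by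
    (l + m) (<V, D> - m |V|^2). *)
Lemma grad_step_contraction (e : R) X Y : 0 <= e -> 0 <= m -> e * (m + l) <= 2 ->
  frobn ((X - e *: dG X) - (Y - e *: dG Y)) <= (1 - e * m) * frobn (X - Y).
Proof.
move=> e0 m0 eml.
have em1 : 0 <= 1 - e * m.
  have : 0 <= e * (l - m) by rewrite mulr_ge0 // subr_ge0 ltW.
  by move=> h; lra.
have -> : (X - e *: dG X) - (Y - e *: dG Y) = (X - Y) - e *: (dG X - dG Y).
  by apply/matrixP => i j; rewrite !mxE; ring.
rewrite ler_frobn ?mulr_ge0 ?frobn_ge0 // exprMn sqr_frobn.
have := half_cocoercive (erefl : _ = dG Y - dG X - m *: (Y - X)).
have := half_cocoercive (erefl : _ = dG X - dG Y - m *: (X - Y)).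
have -> : dG Y - dG X - m *: (Y - X) = - (dG X - dG Y - m *: (X - Y)).
  by apply/matrixP => i j; rewrite !mxE; ring.
have: mdot (dG X - dG Y) (X - Y) = mdot (dG X) (X - Y) - mdot (dG Y) (X - Y).
  exact: mdotBl.
rewrite -(opprB X Y); move: (X - Y) (dG X - dG Y) => V D DV.
have h0 : 0 <= mdot (D - m *: V) (D - m *: V) by rewrite -frob2E frob2_ge0.
have v0 : 0 <= mdot V V by rewrite -frob2E frob2_ge0.
move: h0; rewrite !(mdotNl, mdotNr) !opprK => h0 h1 h2.
set w := mdot (D - _) _ in h0 h1 h2.
have wE : w = mdot D D - 2 * m * mdot V D + m ^+ 2 * mdot V V.
  by rewrite /w !(mdotBl, mdotBr, mdotZl, mdotZr) (mdotC D V); ring.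
rewrite !(mdotBl, mdotBr, mdotZl, mdotZr) (mdotC D V).
rewrite mdotC in DV; move: DV wE v0 h0 h1 h2.
move: (mdot V D) (mdot V V) (mdot D D) (mdot (dG X) V) (mdot (dG Y) V) => u v ww a b.
have lm0 : 0 < l - m by rewrite subr_gt0.
rewrite invfM; have k0 : 0 < (l - m)^-1 by rewrite invr_gt0.
set k := (l - m)^-1 in k0 *; move=> uE wE v0 h0 h1 h2.
have h3 : k * w <= u - m * v by lra.
have h4 : w <= (l - m) * (u - m * v) by rewrite -ler_pdivrMl.
have h5 : ww - m ^+ 2 * v <= (l + m) * (u - m * v) by rewrite wE in h4; lra.
have h6 : 0 <= u - m * v by apply: le_trans h3; rewrite mulr_ge0 // ltW.
have h7 : e * (ww - m ^+ 2 * v) <= 2 * (u - m * v) by nra.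
nra.
Qed.

End Smooth.
End StronglyConvexSmooth.

Section Rows.
Variables (R : realType) (N d : nat).
Implicit Types X Y : 'M[R]_(N, d).

Lemma mdot_rows X Y : mdot X Y = \sum_i mdot (row i X) (row i Y).
Proof.
rewrite mdotE; apply: eq_bigr => i _; rewrite mdotE big_ord1.
by apply: eq_bigr => j _; rewrite !mxE.
Qed.

Lemma le_frobn_row X i : frobn (row i X) <= frobn X.
Proof.
rewrite ler_frobn ?frobn_ge0 // sqr_frobn mdot_rows (bigD1 i) //= lerDl.
by apply: sumr_ge0 => k _; rewrite -frob2E frob2_ge0.
Qed.

Lemma frobn_rows_le X (a : R) : 0 <= a -> (forall i, frobn (row i X) <= a) ->
  frobn X <= Num.sqrt N%:R * a.
Proof.
move=> a0 Xa; rewrite ler_frobn ?mulr_ge0 ?sqrtr_ge0 // mdot_rows exprMn.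
rewrite sqr_sqrtr ?ler0n //.
apply: le_trans (_ : \sum_(i < N) a ^+ 2 <= _).
  by apply: ler_sum => i _; rewrite -ler_frobn.
by rewrite sumr_const card_ord mulr_natl.
Qed.

Lemma quadLE (Lap : 'M[R]_N) X : quadL Lap X = mdot X (Lap *m X).
Proof.
rewrite mdotE /quadL; apply: eq_bigr => i _.
under eq_bigr do rewrite /dotr mulr_sumr.
rewrite exchange_big /=; apply: eq_bigr => j _.
rewrite [(Lap *m X) i j]mxE mulr_sumr; apply: eq_bigr => k _; rewrite !mxE; ring.
Qed.

End Rows.

(** * The penalized objective *)

Section Objective.
Variables (R : realType) (N d : nat).
Variables (f : 'I_N -> 'rV[R]_d -> R) (g : 'I_N -> 'rV[R]_d -> 'rV[R]_d) (mu L : R).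
Hypothesis Hgrad : forall i, is_gradient (f i) (g i).
Hypothesis Hsc : forall i, strongly_convex mu (f i).
Hypothesis Hsm : forall i, lipschitz_grad L (g i).
Hypothesis HL : 0 <= L.
Implicit Types X Y : 'M[R]_(N, d).

Lemma row_gradf X i : row i (gradf g X) = g i (row i X).
Proof. by apply/rowP => j; rewrite !mxE. Qed.

Lemma rowB X Y i : row i (X - Y) = row i X - row i Y.
Proof. by rewrite linearB. Qed.

Lemma fsum_lower : lower_quad mu (fsum f) (gradf g).
Proof.
move=> X Y; rewrite !mdot_rows mulr_sumr -!big_split /=; apply: ler_sum => i _.
by rewrite row_gradf rowB; apply: strongly_convex_grad.
Qed.

Lemma fsum_upper : upper_quad L (fsum f) (gradf g).
Proof.
move=> X Y; rewrite !mdot_rows mulr_sumr -!big_split /=; apply: ler_sum => i _.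
by rewrite row_gradf rowB; apply: lipschitz_descent.
Qed.

Lemma gradf_lipschitz X Y : frobn (gradf g X - gradf g Y) <= L * frobn (X - Y).
Proof.
rewrite ler_frobn ?mulr_ge0 ?frobn_ge0 // exprMn sqr_frobn !mdot_rows mulr_sumr.
apply: ler_sum => i _; rewrite !rowB !row_gradf -!sqr_frobn -exprMn.
rewrite ler_sqr ?nnegrE ?mulr_ge0 ?frobn_ge0 //.
by rewrite -!nrmE; apply: Hsm.
Qed.

Variables (Lap : 'M[R]_N) (r c : R).
Hypothesis Lsym : Lap^T = Lap.
Hypothesis Lge0 : forall X, 0 <= mdot X (Lap *m X).
Hypothesis Lle : forall X, mdot X (Lap *m X) <= r * mdot X X.
Hypothesis c0 : 0 <= c.

Definition penalized X := fsum f X + c / 2 * quadL Lap X.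
Definition grad_penalized X := gradf g X + c *: (Lap *m X).

Lemma quadL_expand X Y : quadL Lap Y =
  quadL Lap X + 2 * mdot (Lap *m X) (Y - X) + mdot (Y - X) (Lap *m (Y - X)).
Proof.
have {1}-> : Y = X + (Y - X) by rewrite addrC subrK.
move: (Y - X) => V; rewrite !quadLE mulmxDr !mdotDl !mdotDr.
by rewrite (mdot_symL Lsym X V) (mdotC V (_ *m X)) (mdot_symL Lsym X V); ring.
Qed.

Lemma mdot_penalized X V :
  mdot (grad_penalized X) V = mdot (gradf g X) V + c * mdot (Lap *m X) V.
Proof. by rewrite mdotDl mdotZl. Qed.

Lemma penalized_lower : lower_quad mu penalized grad_penalized.
Proof.
move=> X Y; have := fsum_lower X Y; rewrite /penalized (quadL_expand X Y).
rewrite mdot_penalized => h.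
have := mulr_ge0 c0 (Lge0 (Y - X)); lra.
Qed.

Lemma penalized_upper : upper_quad (L + c * r) penalized grad_penalized.
Proof.
move=> X Y; have := fsum_upper X Y; rewrite /penalized (quadL_expand X Y).
rewrite mdot_penalized => h.
have := ler_wpM2l c0 (Lle (Y - X)); lra.
Qed.

End Objective.

(** * Existence of minimizers over products of compact sets *)

Section Existence.
Variables (R : realType) (N d : nat).
Variable S : set 'rV[R]_d.

Lemma setN_convex : convex_set S -> convex_mx (@setN R N d S).
Proof.
move=> cS X Y t /andP[t0 t1] SX SY i.
have /set_mem := cS _ _ (Itv01 t0 t1) (mem_set (SX i)) (mem_set (SY i)).
by congr (S _); apply/rowP => j; rewrite !mxE.
Qed.

Lemma continuous_sum (T : topologicalType) (I : Type) (s : seq I) (F : I -> T -> R) :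
  (forall i, continuous (F i)) -> continuous (fun x => \sum_(i <- s) F i x).
Proof.
move=> cF x; elim: s => [|i s IH].
  by under eq_fun do rewrite big_nil; exact: cvg_cst.
under eq_fun do rewrite big_cons.
exact: (@continuousD _ _ _ (F i) (fun x => \sum_(j <- s) F j x) x (cF i x) IH).
Qed.

Lemma entry_continuous (T : topologicalType) m n (i : 'I_m) (j : 'I_n) :
  continuous (fun M : 'M[T]_(m, n) => M i j).
Proof.
move=> M s Ms; exists (fun i' j' => [set x | i' = i -> j' = j -> s x]) => [i' j'|M' h].
  have [->|ii] := eqVneq i' i; last first.
    by apply: filterS filterT => x _ /eqP; rewrite (negPf ii).
  have [->|jj] := eqVneq j' j; first by apply: (filterS _ Ms) => x sx _ _.
  by apply: filterS filterT => x _ _ /eqP; rewrite (negPf jj).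
exact: h.
Qed.

(** Compactness of W^N is Tychonoff for rows whose entries are row vectors ([rV_compact]); [stack]
    transports it to N x d matrices. *)
Local Notation stack := (fun V : 'rV['rV[R]_d]_N => \matrix_(i < N, j < d) V ord0 i ord0 j).

Lemma row_stack (V : 'rV['rV[R]_d]_N) i : row i (stack V) = V ord0 i.
Proof. by apply/rowP => j; rewrite !mxE. Qed.

Lemma continuous_stack i j : continuous (fun V => stack V i j : R).
Proof.
move=> V; under eq_fun do rewrite mxE.
apply: (@continuous_comp _ _ _ (fun V : 'rV['rV[R]_d]_N => V ord0 i) (fun w => w ord0 j)).
  exact: entry_continuous.
exact: entry_continuous.
Qed.

Lemma compact_minimizer (G : 'M[R]_(N, d) -> R) :
  compact S -> S !=set0 -> continuous (G \o stack) ->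
  exists P, minimizer (@setN R N d S) G P.
Proof.
move=> cS [w Sw] cG.
have cK := @rV_compact _ N (fun=> S) (fun=> cS).
have K0 : [set V : 'rV['rV[R]_d]_N | forall i, S (V ord0 i)] !=set0.
  by exists (const_mx w) => i; rewrite mxE.
have [V KV minV] := compact_EVT_min K0 cK (continuous_subspaceT cG).
exists (stack V); split=> [i|Q SQ]; first by rewrite row_stack; exact: (set_mem KV).
have E : stack (\row_i row i Q) = Q by apply/matrixP => i j; rewrite !mxE.
rewrite -[in leRHS]E; apply: minV.
by apply/mem_set => i; rewrite mxE.
Qed.

Lemma continuous_dist (X : 'M[R]_(N, d)) :
  continuous ((fun Y => frob2 (X - Y)) \o stack).
Proof.
rewrite /frob2 /=; apply: continuous_sum => i; apply: continuous_sum => j V.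
have c1 : {for V, continuous (fun V => X i j - stack V i j)}.
  exact: (@continuousB _ _ _ (fun=> X i j) (fun V => stack V i j) V
            (@cst_continuous _ _ _ _) (@continuous_stack i j V)).
have := continuousM c1 c1; congr continuous_at; apply/funext => U.
have E (A B : 'M[R]_(N, d)) : (A - B) i j = A i j - B i j by rewrite !mxE.
by rewrite E expr2.
Qed.

Lemma continuous_penalized (f : 'I_N -> 'rV[R]_d -> R) (Lap : 'M[R]_N) c :
  (forall i, continuous (f i)) -> continuous (penalized f Lap c \o stack).
Proof.
move=> cf V.
have c1 : continuous (fun V => fsum f (stack V)).
  apply: continuous_sum => i U; under eq_fun do rewrite row_stack.
  apply: (@continuous_comp _ _ _ (fun V : 'rV['rV[R]_d]_N => V ord0 i) (f i)).
    exact: entry_continuous.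
  exact: cf.
have c2 : continuous (fun V => quadL Lap (stack V)).
  apply: continuous_sum => i; apply: continuous_sum => j U.
  apply: (@continuousM _ _ (fun=> Lap i j) (fun V => dotr (row i (stack V)) (row j (stack V)))).
    exact: cst_continuous.
  apply: continuous_sum => k {}U.
  have := continuousM (@continuous_stack i k U) (@continuous_stack j k U).
  by congr continuous_at; apply/funext => U'; rewrite ![in RHS]mxE /= ![in LHS]mxE.
apply: (@continuousD _ _ _ (fun V => fsum f (stack V)) (fun V => c / 2 * quadL Lap (stack V))).
  exact: c1.
apply: (@continuousM _ _ (fun=> c / 2)); last exact: c2.
exact: cst_continuous.
Qed.

End Existence.


(** * Projection onto W^N *)

Section Projection.
Variables (R : realType) (N d : nat) (S : set 'rV[R]_d).
Hypotheses (cS : compact S) (cvS : convex_set S) (S0 : S !=set0).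
Implicit Types X Y P Q : 'M[R]_(N, d).
Local Notation pr := (Defs.proj (@setN R N d S)).

(** [proj] is a choice with default X; a nearest point exists by compactness, which excludes the
    default. *)
Lemma proj_minimizer X : minimizer (@setN R N d S) (fun Y => frob2 (X - Y)) (pr X).
Proof.
have cd := @continuous_dist R N d X. have [P [SP minP]] := @compact_minimizer R N d S _ cS S0 cd.
rewrite /Defs.proj; case: xgetP => [Q _ [SQ minQ]|/(_ P)[]].
  split=> // Z SZ; have := minQ _ SZ.
  by rewrite ler_sqrt ?frob2_ge0.
by split=> // Q SQ; rewrite ler_sqrt ?frob2_ge0 // minP.
Qed.

Lemma proj_in X : setN S (pr X).
Proof. by case: (proj_minimizer X). Qed.

(** The obtuse-angle characterization of the projection P of X. As a predicate it also covers a
    point of the set seen as its own projection. *)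
Definition proj_vi X P := forall Z, setN S Z -> 0 <= mdot (P - X) (Z - P).

Lemma proj_viP X : proj_vi X (pr X).
Proof.
move=> Z SZ; have up : upper_quad 2 (fun Y => frob2 (X - Y)) (fun Y => 2 *: (Y - X)).
  move=> Y Q; rewrite !frob2E.
  have -> : X - Q = (X - Y) - (Q - Y).
    by apply/matrixP => i j; rewrite !mxE; ring.
  rewrite -(opprB X Y); move: (X - Y) (Q - Y) => U V.
  rewrite !(mdotBl, mdotBr, mdotZl, mdotNl) (mdotC V U); lra.
have := minimizer_vi up (setN_convex cvS) (proj_minimizer X) SZ.
by rewrite mdotZl pmulr_rge0.
Qed.

(** Adding the two variational inequalities, each tested at the other point, gives |P - Q|^2 <= <X -
    Y, P - Q>. *)
Lemma proj_nonexpansive X Y P Q : setN S P -> setN S Q ->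
  proj_vi X P -> proj_vi Y Q -> frobn (P - Q) <= frobn (X - Y).
Proof.
move=> SP SQ /(_ _ SQ) h1 /(_ _ SP) h2.
have [PQ|PQ] := eqVneq (frobn (P - Q)) 0; first by rewrite PQ frobn_ge0.
have PQ0 : 0 < frobn (P - Q) by rewrite lt_def PQ frobn_ge0.
rewrite -(ler_pM2r PQ0) -expr2 sqr_frobn; apply: le_trans (mdot_le _ _).
move: h1 h2; rewrite -(opprB P Q) mdotNr.
have -> : P - X = (P - Q) + (Q - Y) - (X - Y).
  by apply/matrixP => i j; rewrite !mxE; ring.
move: (P - Q) (Q - Y) (X - Y) => U V T; rewrite mdotBl mdotDl => h1 h2; lra.
Qed.

End Projection.

(** * Sup norm versus Euclidean norm, diameter and distance to the boundary *)

Section SupNorm.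
Variables (R : realType) (d : nat).
Implicit Types (u v w x : 'rV[R]_d) (S : set 'rV[R]_d).

Lemma normr_entry_le u j : `|u ord0 j| <= `|u|.
Proof.
rewrite [leRHS]/Num.norm /= mx_normrE.
exact: (le_bigmax _ (fun ij : 'I_1 * 'I_d => `|u ij.1 ij.2|) (ord0, j)).
Qed.

Lemma normr_le_frobn u : `|u| <= frobn u.
Proof.
rewrite {1}/Num.norm /= mx_normrE; apply/bigmax_leP; split=> [|[i j] _] /=.
  exact: frobn_ge0.
rewrite ord1 -ler_sqr ?nnegrE ?normr_ge0 ?frobn_ge0 // real_normK ?num_real //.
rewrite sqr_frobn mdotE big_ord1 (bigD1 j) //= -expr2 lerDl.
by apply: sumr_ge0 => k _; rewrite -expr2 sqr_ge0.
Qed.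

Lemma frobn_le_normr u : frobn u <= Num.sqrt d%:R * `|u|.
Proof.
rewrite ler_frobn ?mulr_ge0 ?sqrtr_ge0 ?normr_ge0 // exprMn sqr_sqrtr ?ler0n //.
rewrite mdotE big_ord1 mulr_natl; apply: le_trans (_ : \sum_(j < d) `|u| ^+ 2 <= _).
  apply: ler_sum => j _; rewrite -expr2 -real_normK ?num_real //.
  by rewrite ler_sqr ?nnegrE ?normr_ge0 // normr_entry_le.
by rewrite sumr_const card_ord.
Qed.

Lemma bounded_set_normr S : bounded_set S -> exists2 M, 0 <= M & forall u, S u -> `|u| <= M.
Proof.
move=> [M [_ hM]]; exists (`|M| + 1); first by rewrite addr_ge0.
by move=> u; apply: hM; rewrite (le_lt_trans (ler_norm _)) // ltrDl.
Qed.

Lemma nrm_diam S w w' : bounded_set S -> S w -> S w' -> nrm (w - w') <= diam S.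
Proof.
move=> /bounded_set_normr[M M0 hM] Sw Sw'; apply: ub_le_sup; last by exists w, w'.
exists (Num.sqrt d%:R * (M + M)) => _ [u [u' [Su Su' ->]]].
rewrite nrmE (le_trans (frobn_le_normr _)) // ler_wpM2l ?sqrtr_ge0 //.
by rewrite (le_trans (ler_normB _ _)) // lerD // hM.
Qed.

Lemma diam_ge0 S : bounded_set S -> S !=set0 -> 0 <= diam S.
Proof.
by move=> bS [w Sw]; apply: le_trans (nrm_diam bS Sw Sw); rewrite nrmE frobn_ge0.
Qed.

Lemma line_continuous w v : continuous (fun t : R => w + t *: v).
Proof.
move=> t; apply: cvgD; first exact: cvg_cst.
by apply: cvgZr_tmp; exact: cvg_id.
Qed.

(* The last point of the segment from ws to x that lies in S is a boundary
   point, so it is at distance at least zeta from ws. *)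
Lemma zeta_ball S ws x : closed S -> S ws -> nrm (x - ws) <= zeta_of S ws -> S x.
Proof.
move=> clS Sws xz; apply: contrapT => Sx.
pose A := `[0, 1]%classic `&` [set t : R | S (ws + t *: (x - ws))].
have cA : compact A.
  apply: (subclosed_compact _ (@segment_compact R 0 1)); last by move=> t [].
  apply: closedI; first exact: interval_closed.
  by apply: preimage_closed clS => t _; exact: line_continuous.
have A0 : A !=set0.
  by exists 0; split; rewrite /= ?in_itv /= ?lexx ?ler01 // scale0r addr0.
have [s /set_mem[]] := compact_EVT_max A0 cA (continuous_subspaceT (fun _ => cvg_id)).
rewrite /= in_itv /= => /andP[s0 s1] Ss smax.
have {}s1 : s < 1.
  rewrite lt_neqAle s1 andbT; apply/negP => /eqP s1'.
  by apply: Sx; move: Ss; rewrite s1' scale1r addrC subrK.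
have bd : bdry S (ws + s *: (x - ws)).
  split; first exact: subset_closure.
  move=> Sint; have : nbhs s [set t : R | S (ws + t *: (x - ws))].
    exact: (@line_continuous ws (x - ws) s).
  (* The cap e / 2 keeps t in the ball around s and the cap 1 - s keeps t <= 1, so t is a point of A
     beyond its maximum s. *)
  move=> /nbhs_ballP[e /= e0 he]; pose t := s + Num.min (e / 2) (1 - s).
  have m0 : 0 < Num.min (e / 2) (1 - s) by rewrite lt_min divr_gt0 //= subr_gt0.
  have me : Num.min (e / 2) (1 - s) <= e / 2 by rewrite ge_min lexx.
  have m1 : Num.min (e / 2) (1 - s) <= 1 - s by rewrite ge_min lexx orbT.
  have St : S (ws + t *: (x - ws)).
    apply: he; rewrite /ball /= /t opprD addrA subrr add0r normrN gtr0_norm //.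
    by rewrite (le_lt_trans me) // ltr_pdivrMr // ltr_pMr // ltr1n.
  have At : t \in A.
    apply/mem_set; split=> //; rewrite /= in_itv /= /t; apply/andP; split; lra.
  by have := smax _ At; rewrite /t; lra.
have lb : zeta_of S ws <= nrm (ws + s *: (x - ws) - ws).
  apply: ge_inf; last by exists (ws + s *: (x - ws)).
  by exists 0 => _ [w _ <-]; rewrite nrmE frobn_ge0.
have := le_trans xz lb; rewrite addrAC subrr add0r !nrmE frobnZ ger0_norm //.
have [|xws] := eqVneq (frobn (x - ws)) 0.
  by move=> /eqP; rewrite frobn_eq0 subr_eq0 => /eqP xws; case: Sx; rewrite xws.
have x0 : 0 < frobn (x - ws) by rewrite lt_def xws frobn_ge0.
by rewrite ler_pMl // leNgt s1.
Qed.

End SupNorm.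

(** * Stationary points *)

Section Stationary.
Variables (R : realType) (N d : nat).
Implicit Types X Y Z : 'M[R]_(N, d).
Variables (G : 'M[R]_(N, d) -> R) (dG : 'M[R]_(N, d) -> 'M[R]_(N, d)) (m l : R).
Hypotheses (m0 : 0 < m) (lo : lower_quad m G dG) (up : upper_quad l G dG).

Lemma lower_quad_dist X Y : G Y <= G X -> frobn (Y - X) <= 2 / m * frobn (dG X).
Proof.
move=> YX; have := lo X Y; rewrite -sqr_frobn => h.
have [->|n0] := eqVneq (frobn (Y - X)) 0.
  by rewrite mulr_ge0 ?frobn_ge0 // divr_ge0 // ltW.
have {}n0 : 0 < frobn (Y - X) by rewrite lt_def n0 frobn_ge0.
have := mdot_le (- dG X) (Y - X); rewrite mdotNl frobnN => h1.
have h2 : m / 2 * frobn (Y - X) <= frobn (dG X).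
  by rewrite -(ler_pM2r n0); rewrite expr2 in h; lra.
rewrite -(ler_pM2l (_ : 0 < m / 2)) ?divr_gt0 //.
by rewrite [leRHS](_ : _ = frobn (dG X)) //; field; rewrite gt_eqF.
Qed.

(** By [lower_quad_dist], every Z with |Z| > r satisfies G Z > G 0, so a minimizer over a compact
    product containing the ball of radius r is global. *)
Lemma exists_stationary :
  continuous (G \o (fun V : 'rV['rV[R]_d]_N => \matrix_(i < N, j < d) V ord0 i ord0 j)) ->
  exists X, dG X = 0.
Proof.
move=> cG; set r := 2 / m * frobn (dG 0).
have r0 : 0 <= r by rewrite mulr_ge0 ?frobn_ge0 // divr_ge0 // ltW.
pose B := [set w : 'rV[R]_d | `|w| <= r].
have bB : bounded_set B.
  by exists r; split; [exact: num_real|move=> M rM w /= wr; rewrite (le_trans wr) // ltW].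
have clB : closed B.
  apply: (@preimage_closed _ _ (fun w : 'rV[R]_d => `|w|) [set t | t <= r]).
    by move=> w _; exact: norm_continuous.
  exact: closed_le.
have B0 : B 0 by rewrite /B /= normr0.
have inB Z : frobn Z <= r -> setN B Z.
  move=> Zr i; rewrite /B /=; apply: le_trans (normr_le_frobn _) _.
  exact: le_trans (le_frobn_row _ _) Zr.
have B0' : setN B (0 : 'M[R]_(N, d)) by apply: inB; rewrite frobn0.
have [X [BX minX]] := compact_minimizer (bounded_closed_compact bB clB)
   (ex_intro _ 0 B0) cG.
have minT : minimizer setT G X.
  split=> // Z _; have [Zr|Zr] := leP (frobn Z) r; first exact/minX/inB.
  rewrite (le_trans (minX _ B0')) // leNgt; apply/negP => /ltW/lower_quad_dist.
  by rewrite subr0 leNgt Zr.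
exists X; apply/eqP; rewrite -frob2_eq0 eq_le frob2_ge0 andbT frob2E.
have cT : convex_mx (@setT 'M[R]_(N, d)) by [].
(* Testing optimality at a gradient step from X gives |dG X|^2 <= 0. *)
have := minimizer_vi (Z := X - dG X) up cT minT I.
by rewrite addrAC subrr add0r mdotNr oppr_ge0.
Qed.

End Stationary.

(** * Measurability and expectations *)

Section MeasurableMatrix.
Variables (R : realType) (N d : nat).
Implicit Types X Y : 'M[R]_(N, d).

Definition norm1 X : R := \sum_i \sum_j `|X i j|.

Lemma frobn_le_norm1 X : frobn X <= norm1 X.
Proof.
have n0 : 0 <= norm1 X by do 2 (apply: sumr_ge0 => ? _).
rewrite ler_frobn // mdotE expr2 mulr_suml; apply: ler_sum => i _.
rewrite mulr_suml; apply: ler_sum => j _.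
apply: le_trans (ler_norm _) _; rewrite normrM ler_wpM2l //.
rewrite /norm1 (bigD1 i) //= (bigD1 j) //= -addrA lerDl addr_ge0 //.
  by apply: sumr_ge0 => ? _.
by do 2 (apply: sumr_ge0 => ? _).
Qed.

Lemma entry_le_frobn X i j : `|X i j| <= frobn X.
Proof.
have -> : X i j = row i X ord0 j by rewrite mxE.
apply: le_trans (normr_entry_le _ _) _.
by apply: le_trans (normr_le_frobn _) _; exact: le_frobn_row.
Qed.

Lemma rat_dense_mx X (e : R) : 0 < e ->
  exists q : 'M[rat]_(N, d), norm1 (X - map_mx ratr q) < e.
Proof.
move=> e0; pose e' := e / (N%:R * d%:R + 1).
have D0 : 0 < N%:R * d%:R + 1 :> R by rewrite ltr_wpDl // mulr_ge0.
have e'0 : 0 < e' by rewrite divr_gt0.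
have /choice[q hq] : forall ij : 'I_N * 'I_d, exists r : rat,
    ratr r \in `]X ij.1 ij.2 - e', X ij.1 ij.2[.
  by move=> ij; apply: rat_in_itvoo; rewrite ltrBlDr ltrDl.
exists (\matrix_(i, j) q (i, j)).
apply: (@le_lt_trans _ _ (\sum_(i < N) \sum_(j < d) e')).

  apply: ler_sum => i _; apply: ler_sum => j _; rewrite !mxE.
  have := hq (i, j); rewrite in_itv /= => /andP[h1 h2].
  by rewrite ger0_norm; lra.
rewrite !sumr_const !card_ord -mulrnA -mulr_natl natrM /e' mulrCA.
rewrite -[ltRHS]mulr1 ltr_pM2l // ltr_pdivrMr // mul1r mulrC ltrDl ltr01.
by [].
Qed.

Section Lipschitz.
Context dsp (T : measurableType dsp).

Definition measurable_mx n m (Y : T -> 'M[R]_(n, m)) :=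
  forall i j, measurable_fun setT (fun w => Y w i j).

(* phi < a iff phi q + |. - q|_1 < a for some rational matrix q, so the
   sublevel sets of phi \o Y are countable unions of measurable sets. *)
Lemma measurable_lipschitz (phi : 'M[R]_(N, d) -> R) (Y : T -> 'M[R]_(N, d)) :
  (forall X X', `|phi X - phi X'| <= frobn (X - X')) ->
  measurable_mx Y -> measurable_fun setT (phi \o Y).
Proof.
move=> lip mY.
have mn (q : 'M[R]_(N, d)) : measurable_fun setT (fun w => phi q + norm1 (Y w - q)).
  apply: measurable_funD => //; apply: measurable_sum => i.
  apply: measurable_sum => j; apply: measurableT_comp => //.
  under eq_fun do rewrite !mxE.
  exact: measurable_funB.
apply: (measurability _ (RGenInftyO.measurableE R)) => _ [_ [a ->] <-].
have -> : setT `&` (phi \o Y) @^-1` `]-oo, a[%classic =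
  \bigcup_(q : 'M[rat]_(N, d)) [set w | phi (map_mx ratr q) + norm1 (Y w - map_mx ratr q) < a].
  apply/seteqP; split=> [w [_ /=]|w [q _ /=]].
    rewrite in_itv /= => wa.
    have [|q hq] := @rat_dense_mx (Y w) ((a - phi (Y w)) / 2); first by rewrite divr_gt0 // subr_gt0.
    exists q => //=; have := le_trans (lip (Y w) (map_mx ratr q)) (frobn_le_norm1 _).
    by rewrite ler_norml => /andP[h1 h2]; lra.
  move=> h; split=> //; rewrite /= in_itv /=.
  have := le_trans (lip (Y w) (map_mx ratr q)) (frobn_le_norm1 _).
  by rewrite ler_norml => /andP[h1 h2]; lra.
apply: countable_bigcupT_measurable; first exact: countableP.
move=> q; have := measurable_fun_ltr (mn (map_mx ratr q)) (@measurable_cst _ _ T R setT a).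
move=> /(_ measurableT [set true]); rewrite setTI; exact.
Qed.

End Lipschitz.
End MeasurableMatrix.

(** The sum is the smaller of K and the integer part of y: a staircase made of indicators, within 1
    of y as long as y <= K. *)
Lemma truncation_error (R : realType) (y : R) (K : nat) : 0 <= y ->
  let s := \sum_(m < K) (m.+1%:R <= y)%R%:R in
  if K%:R <= y then s = K%:R else y - 1 <= s <= y.
Proof.
move=> y0 /=; elim: K => [|K IH]; first by rewrite big_ord0 y0.
rewrite big_ord_recr /=; case: ifPn => [Ky|Ky].
  have Ky' : K%:R <= y by apply: le_trans Ky; rewrite ler_nat.
  by move: IH; rewrite Ky' => ->; rewrite -[in RHS]natr1 Ky.
rewrite (negPf Ky) addr0; move: IH; case: ifPn => // Ky' ->.
move: Ky; rewrite -ltNge -natr1 => Ky; apply/andP; split; lra.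
Qed.

(** * Conditionally centered noise *)

Section SubSigmaAlgebra.
Context (R : realType) (dsp : measure_display) (Om : measurableType dsp).
Variable G : set (set Om).
Hypothesis sG : sigma_algebra setT G.

(** Viewing G as the sigma-algebra of a measurable type makes the closure lemmas for measurable
    functions available for F_k. *)
Lemma GmeasP (Y : Om -> R) :
  Gmeas G Y <-> measurable_fun [set: g_sigma_algebraType G] Y.
Proof.
split=> [mY _ B mB|mY B mB].
  by rewrite setTI; apply: sub_sigma_algebra; exact: mY.
have := mY measurableT B mB; rewrite setTI.
by rewrite (measurable_g_measurableTypeE sG).
Qed.

Lemma Gmeas_mxP n m (Y : Om -> 'M[R]_(n, m)) :
  Gmeas_mx G Y <-> @measurable_mx R _ (g_sigma_algebraType G) n m Y.
Proof.
split=> h i j; first exact: (proj1 (GmeasP _) (h i j)).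
exact: (proj2 (GmeasP _) (h i j)).
Qed.

Lemma Gmeas_measurable (Y : Om -> R) :
  G `<=` measurable -> Gmeas G Y -> measurable_fun setT Y.
Proof. by move=> GM mY _ B mB; rewrite setTI; exact/GM/mY. Qed.

End SubSigmaAlgebra.

Section ConditionallyCentered.
Context (R : realType) (dsp : measure_display) (Om : measurableType dsp)
        (P : probability Om R).
Variable G : set (set Om).
Hypothesis sG : sigma_algebra setT G.
Hypothesis GM : G `<=` measurable.
Local Notation EP := (Rintegral P setT).

Let GT : G setT.
Proof. by have [G0 GC _] := sG; rewrite -(setD0 setT); exact: GC. Qed.

Variable e : Om -> R.
Hypothesis He : is_cond_exp P G e (fun=> 0).

Let ie : P.-integrable setT (EFin \o e). Proof. by case: He. Qed.

Lemma centered_Rintegral0 A : G A -> \int[P]_(w in A) e w = 0.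
Proof.
case: He => _ _ _ h GA; rewrite /Rintegral h //.
by rewrite integral_cst ?mul0e //; exact: GM.
Qed.

Lemma integrable_bounded_mul (Y : Om -> R) (M : R) : measurable_fun setT Y ->
  (forall w, `|Y w| <= M) -> P.-integrable setT (EFin \o (fun w => Y w * e w)).
Proof.
move=> mY YM; apply: (integrableMr (h := Y) _ mY _ ie) => //.
exists M; split; first exact: num_real.
by move=> x Mx w _ /=; rewrite (le_trans (YM w)) // ltW.
Qed.

Lemma centered_indic A : G A -> EP (fun w => \1_A w * e w) = 0.
Proof.
move=> GA; rewrite -(centered_Rintegral0 GA) [RHS]Rintegral_mkcond.
apply: eq_Rintegral => w _; rewrite /patch indicE.
by case: ifPn; rewrite ?mul1r ?mul0r.
Qed.

Lemma measurable_sum_indic (A : nat -> set Om) K : (forall m, G (A m)) ->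
  measurable_fun setT (fun w => \sum_(m < K) \1_(A m) w : R).
Proof.
move=> GA; apply: measurable_sum => m.
exact/measurable_indic/GM.
Qed.

Lemma integrable_sum_indic (A : nat -> set Om) K : (forall m, G (A m)) ->
  P.-integrable setT (EFin \o (fun w => (\sum_(m < K) \1_(A m) w) * e w)).
Proof.
move=> GA; apply: (@integrable_bounded_mul _ K%:R).
  exact: measurable_sum_indic.
move=> w; rewrite ger0_norm; last by apply: sumr_ge0 => m _; rewrite indicE.
apply: le_trans (_ : \sum_(m < K) 1 <= _).
  by apply: ler_sum => m _; rewrite indicE lern1 leq_b1.
by rewrite sumr_const card_ord.
Qed.

Lemma centered_sum_indic (A : nat -> set Om) K : (forall m, G (A m)) ->
  EP (fun w => (\sum_(m < K) \1_(A m) w) * e w) = 0.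
Proof.
move=> GA; elim: K => [|K IH].
  rewrite -[RHS](mul0r (fine (P setT))) -Rintegral_cst //.
  by apply: eq_Rintegral => w _; rewrite big_ord0 mul0r.
have -> : EP (fun w => (\sum_(m < K.+1) \1_(A m) w) * e w) =
    EP (fun w => (\sum_(m < K) \1_(A m) w) * e w + \1_(A K) w * e w).
  by apply: eq_Rintegral => w _; rewrite big_ord_recr mulrDl.
rewrite RintegralD //; first by rewrite IH centered_indic // addr0.
  exact: integrable_sum_indic.
apply: (@integrable_bounded_mul _ 1); first exact/measurable_indic/GM.
by move=> w; rewrite indicE; case: (_ \in _); rewrite ?normr1 ?normr0.
Qed.

(** Conditional expectation is tested on sets of G only. Since n Y is within 1 of a finite sum of
    indicators of such sets, whose products with e have mean 0, n |E[Y e]| <= E|e| for every n, and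
    so E[Y e] = 0. *)
Lemma centered_mul_ge0 (Y : Om -> R) (M : R) : Gmeas G Y ->
  (forall w, 0 <= Y w <= M) -> EP (fun w => Y w * e w) = 0.
Proof.
move=> mY Y0M; have mYT := Gmeas_measurable GM mY.
have YM w : `|Y w| <= M by have /andP[y0 yM] := Y0M w; rewrite ger0_norm.
set c := EP (fun w => `|e w|).
have c_ge0 : 0 <= c by apply: Rintegral_ge0.
suff h (n : nat) : n%:R * `|EP (fun w => Y w * e w)| <= c.
  apply/eqP; rewrite -normr_eq0 eq_le normr_ge0 andbT leNgt; apply/negP => a0.
  have := archi_boundP (divr_ge0 c_ge0 (ltW a0)).
  by rewrite ltr_pdivrMr // ltNge h.
pose Z w := n%:R * Y w.
have mZ : Gmeas G Z.
  by apply/(GmeasP sG); apply: measurable_funM => //; exact/(GmeasP sG).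
(* K dominates n Y, so the staircase saturates only where n Y equals K. *)
pose K := Num.bound (n%:R * M).
pose A m := [set w | m.+1%:R <= Z w].
have GA m : G (A m).
  have := mZ _ (@measurable_itv R `[m.+1%:R, +oo[); congr G.
  by apply/seteqP; split=> w; rewrite /A /= in_itv /= andbT.
pose s w : R := \sum_(m < K) \1_(A m) w.
have Zs w : `|Z w - s w| <= 1.
  have /andP[y0 yM] := Y0M w.
  have Z0 : 0 <= Z w by rewrite mulr_ge0.
  have ZK : Z w <= K%:R.
    apply: le_trans (_ : n%:R * M <= _); first by rewrite ler_wpM2l.
    by apply/ltW/archi_boundP; rewrite mulr_ge0 // (le_trans y0).
  have := truncation_error K Z0; rewrite /=.
  have -> : \sum_(m < K) (m.+1%:R <= Z w)%R%:R = s w.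
    apply: eq_bigr => m _; rewrite indicE; congr (_%:R); congr nat_of_bool.
    by apply/idP/idP => [h|/set_mem//]; exact/mem_set.
  case: ifPn => KZ.
    by move=> ->; rewrite (@le_anti _ _ (Z w) K%:R) ?subrr ?normr0 // ZK KZ.
  by move=> /andP[h1 h2]; rewrite ler_norml; apply/andP; split; lra.
have iY := integrable_bounded_mul mYT YM.
have mZs : measurable_fun setT (fun w => Z w - s w).
  apply: measurable_funB; first exact: (Gmeas_measurable GM mZ).
  exact: measurable_sum_indic.
have -> : n%:R * `|EP (fun w => Y w * e w)| = `|EP (fun w => (Z w - s w) * e w)|.
  rewrite -[n%:R]ger0_norm // -normrM -RintegralZl //.
  have -> : EP (fun w => n%:R * (Y w * e w)) =
            EP (fun w => (Z w - s w) * e w + s w * e w).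
    by apply: eq_Rintegral => w _; rewrite /Z; ring.
  rewrite RintegralD //; first by rewrite centered_sum_indic // addr0.
    exact: (integrable_bounded_mul mZs Zs).
  exact: integrable_sum_indic.
have iZs := integrable_bounded_mul mZs Zs.
apply: le_trans (le_normr_Rintegral measurableT iZs) _.
apply: le_Rintegral => //; [exact: integrable_norm iZs|exact: integrable_norm ie|].
by move=> w _; rewrite normrM -[leRHS]mul1r ler_wpM2r.
Qed.

(** Shifting by M reduces to a nonnegative factor, and M e has mean 0. *)
Lemma centered_mul (Y : Om -> R) (M : R) : Gmeas G Y ->
  (forall w, `|Y w| <= M) -> EP (fun w => Y w * e w) = 0.
Proof.
move=> mY YM; have mYT := Gmeas_measurable GM mY.
have mYM : Gmeas G (fun w => Y w + M).
  by apply/(GmeasP sG); apply: measurable_funD => //; exact/(GmeasP sG).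
have h0 : EP (fun w => (Y w + M) * e w) = 0.
  apply: (@centered_mul_ge0 _ (M + M)) => // w.
  by have := YM w; rewrite ler_norml => /andP[h1 h2]; apply/andP; split; lra.
have h1 : EP e = 0 by exact: centered_Rintegral0.
have -> : EP (fun w => Y w * e w) = EP (fun w => (Y w + M) * e w - M * e w).
  by apply: eq_Rintegral => w _; ring.
rewrite RintegralB //; first by rewrite h0 RintegralZl // h1 mulr0 subr0.
  apply: (@integrable_bounded_mul _ (M + M)); first exact: (Gmeas_measurable GM mYM).
  move=> w; apply: le_trans (ler_normD _ _) _; rewrite lerD // ger0_norm //.
  by apply: le_trans (YM w).
exact: (@integrable_bounded_mul (fun=> M) `|M|).
Qed.

End ConditionallyCentered.

Section Expectation.
Context (R : realType) (dsp : measure_display) (Om : measurableType dsp)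
        (P : probability Om R).
Local Notation EP := (Rintegral P setT).

(** Integrability travels with the value, so the mean of a long expression is obtained by composing
    lemmas. *)
Definition has_mean (f : Om -> R) (m : R) :=
  P.-integrable setT (EFin \o f) /\ EP f = m.

Lemma has_meanD f f' m m' : has_mean f m -> has_mean f' m' ->
  has_mean (fun w => f w + f' w) (m + m').
Proof.
move=> [fi <-] [fi' <-]; split; last by rewrite RintegralD.
exact: (integrableD measurableT fi fi').
Qed.

Lemma has_meanZ f m a : has_mean f m -> has_mean (fun w => a * f w) (a * m).
Proof.
move=> [fi <-]; split; last by rewrite RintegralZl.
exact: (integrableZl measurableT a fi).
Qed.

Lemma has_mean_cst c : has_mean (fun=> c) c.
Proof.
split; first exact: finite_measure_integrable_cst.
rewrite Rintegral_cst // -[RHS]mulr1; congr (_ * _).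
by rewrite -[RHS]/(fine 1%E); congr fine; exact: probability_setT.
Qed.

Lemma has_mean_sum0 I (s : seq I) (f : I -> Om -> R) :
  (forall i, has_mean (f i) 0) -> has_mean (fun w => \sum_(i <- s) f i w) 0.
Proof.
move=> hf; elim: s => [|i s IH].
  by under eq_fun do rewrite big_nil; exact: has_mean_cst.
by under eq_fun do rewrite big_cons; have := has_meanD (hf i) IH; rewrite addr0.
Qed.

Lemma has_mean_le f f' m m' : has_mean f m -> has_mean f' m' ->
  (forall w, f w <= f' w) -> m <= m'.
Proof. by move=> [fi <-] [fi' <-] ff'; exact: le_Rintegral. Qed.

Lemma has_mean_ae_le f m c : has_mean f m -> {ae P, forall w, f w <= c} -> m <= c.
Proof.
move=> [fi <-] [A [mA PA0 fA]].
have ci := finite_measure_integrable_cst P c measurableT.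
have [_ <-] := has_mean_cst c; rewrite /Rintegral.
rewrite (negligible_integral mA measurableT fi PA0).
rewrite (negligible_integral mA measurableT ci PA0).
have mTA : measurable (setT `\` A) by exact: measurableD.
apply: le_Rintegral => //.
- exact: (integrableS measurableT mTA _ fi).
- exact: (integrableS measurableT mTA _ ci).
- by move=> w [_ Aw]; apply: contrapT => fw; apply: Aw; exact: fA.
Qed.

Lemma cond_exp_mean G (f : Om -> R) (Y : Om -> R) (c : R) :
  sigma_algebra setT G -> is_cond_exp P G f Y ->
  {ae P, forall w, Y w <= c} -> exists2 m, has_mean f m & m <= c.
Proof.
move=> sG [_ fi Yi fY] Yc; exists (EP f) => //.
have GT : G setT by have [G0 GC _] := sG; rewrite -(setD0 setT); exact: GC.
have -> : EP f = EP Y by rewrite /Rintegral fY.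
exact: (@has_mean_ae_le Y).
Qed.

Lemma cond_exp0_mean G (f : Om -> R) :
  sigma_algebra setT G -> is_cond_exp P G f (fun=> 0) -> has_mean f 0.
Proof.
move=> sG [_ fi Yi fY]; split=> //.
have GT : G setT by have [G0 GC _] := sG; rewrite -(setD0 setT); exact: GC.
by have [_ h] := has_mean_cst 0; rewrite -[RHS]h /Rintegral fY.
Qed.

End Expectation.

(** * Penalized minimizers *)

Section Consensus.
Variables (R : realType) (N d : nat).
Variables (f : 'I_N -> 'rV[R]_d -> R) (g : 'I_N -> 'rV[R]_d -> 'rV[R]_d) (mu L : R).
Hypotheses (HN : (2 <= N)%N) (Hmu : 0 < mu) (HmuL : mu <= L).
Hypothesis Hgrad : forall i, is_gradient (f i) (g i).
Hypothesis Hsc : forall i, strongly_convex mu (f i).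
Hypothesis Hsm : forall i, lipschitz_grad L (g i).
Variable wstar : 'rV[R]_d.
Hypothesis Hmin : forall w, \sum_(i < N) f i wstar <= \sum_(i < N) f i w.
Variables (Lap : 'M[R]_N) (rho : nat -> R).
Hypotheses (Lsym : Lap^T = Lap) (L1 : Lap *m const_mx 1 = 0 :> 'cV[R]_N).
Hypothesis Hchar : char_poly Lap = \prod_(1 <= i < N.+1) ('X - (rho i)%:P).
Hypothesis Hsort : forall i j : nat,
  (1 <= i)%N -> (i <= j)%N -> (j <= N)%N -> rho i <= rho j.
Hypothesis Hrho2 : 0 < rho 2%N.
Implicit Types X Y Z : 'M[R]_(N, d).

Let L0 : 0 <= L. Proof. by rewrite (le_trans _ HmuL) // ltW. Qed.
Let Lge0 X : 0 <= mdot X (Lap *m X).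
Proof. exact: (lap_quad_ge0 HN Lsym L1 Hchar). Qed.
Let Lle X : mdot X (Lap *m X) <= rho N * mdot X X.
Proof. exact: (lap_quad_le Lsym Hchar). Qed.

Lemma solve_zero_sum X : zero_sum X ->
  exists2 Y, Lap *m Y = X & frobn Y <= frobn X / rho 2%N.
Proof.
move=> X0; have [Y Y0 LY] := lap_solve HN Lsym L1 Hchar Hsort Hrho2 X0.
exists Y => //; rewrite ler_pdivlMr // mulrC -LY.
exact: (lap_gap HN Lsym L1 Hchar Hsort Hrho2).
Qed.

Lemma gap_bound X X' Y c : 0 <= c ->
  gradf g X' - gradf g X + c *: (Lap *m (X' - X + Y)) = 0 ->
  frobn (X' - X) <= L / mu * frobn Y.
Proof.
move=> c0 E; set D := X' - X in E *; set De := gradf g X' - gradf g X in E.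
have h1 : mu * mdot D D <= mdot De D by exact: (strong_monotone (fsum_lower Hgrad Hsc)).
have h2 : frobn De <= L * frobn D by exact: gradf_lipschitz.
have h3 : mdot De (D + Y) <= 0.
  have q := mulr_ge0 c0 (Lge0 (D + Y)).
  have := congr1 (fun T => mdot T (D + Y)) E; move: (D + Y) q => V q.
  by rewrite /= mdotDl mdotZl mdot0l (mdotC (Lap *m V)) => h; lra.
have h4 := mdot_le De (- Y); rewrite mdotNr frobnN in h4.
have h5 := ler_wpM2r (frobn_ge0 Y) h2.
rewrite mdotDr in h3; rewrite -sqr_frobn expr2 in h1.
have [->|D0] := eqVneq (frobn D) 0.
  by rewrite mulr_ge0 ?frobn_ge0 // divr_ge0 // ltW.
have {}D0 : 0 < frobn D by rewrite lt_def D0 frobn_ge0.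
rewrite mulrAC ler_pdivlMr // -(ler_pM2r D0); lra.
Qed.

Definition Wst : 'M[R]_(N, d) := \matrix_(i < N, j < d) wstar ord0 j.

Lemma row_Wst i : row i Wst = wstar.
Proof. by apply/rowP => j; rewrite !mxE. Qed.

Lemma lap_consensus (w : 'rV[R]_d) : Lap *m (\matrix_(i < N, j < d) w ord0 j) = 0.
Proof.
have -> : \matrix_(i < N, j < d) w ord0 j = (const_mx 1 : 'cV_N) *m w.
  by apply/matrixP => i j; rewrite !mxE big_ord1 mxE mul1r.
by rewrite mulmxA L1 mul0mx.
Qed.

(** [Wst] minimizes [fsum f] over the consensus subspace; testing against minus the sum s of the
    local gradients gives |s|^2 <= 0. *)
Lemma zero_sum_gradf_Wst : zero_sum (gradf g Wst).
Proof.
pose S := [set X : 'M[R]_(N, d) | exists w : 'rV[R]_d, X = \matrix_(i, j) w ord0 j].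
have cS : convex_mx S.
  move=> _ _ t _ [v ->] [w ->]; exists (t *: v + (1 - t) *: w).
  by apply/matrixP => i j; rewrite !mxE.
have fsumE (w : 'rV[R]_d) : fsum f (\matrix_(i, j) w ord0 j) = \sum_i f i w.
  by apply: eq_bigr => i _; congr (f i _); apply/rowP => j; rewrite !mxE.
have minW : minimizer S (fsum f) Wst.
  split; first by exists wstar.
  by move=> _ [w ->]; rewrite !fsumE.
pose s : 'rV[R]_d := \row_j \sum_i gradf g Wst i j.
have SZ : S (Wst - \matrix_(i, j) s ord0 j).
  by exists (wstar - s); apply/matrixP => i j; rewrite !mxE.
have := minimizer_vi (fsum_upper Hgrad Hsm) cS minW SZ.
rewrite addrAC subrr add0r mdotNr oppr_ge0.
have -> : mdot (gradf g Wst) (\matrix_(i, j) s ord0 j) = frob2 s.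
  rewrite mdotE exchange_big /frob2 big_ord1 /=; apply: eq_bigr => j _.
  under eq_bigr do rewrite [X in _ * X]mxE.
  by rewrite -mulr_suml expr2; congr (_ * _); rewrite mxE.
move=> s0; have /eqP : frob2 s == 0 by rewrite eq_le s0 frob2_ge0.
move/eqP; rewrite frob2_eq0 => /eqP s0'.
by apply/zero_sumE => j; have /rowP/(_ j) := s0'; rewrite !mxE.
Qed.

Lemma frobn_gradf_Wst : frobn (gradf g Wst) <= Num.sqrt N%:R * nabla_star g wstar.
Proof.
apply: frobn_rows_le; first exact: bigmax_ge_id.
move=> i; rewrite row_gradf row_Wst -nrmE.
exact: (le_bigmax _ (fun i => nrm (g i wstar))).
Qed.

Local Notation dG := (grad_penalized g Lap).
Local Notation K := (nabla_star g wstar * L / (mu * rho 2%N)).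

Let K0 : 0 <= K.
Proof.
by rewrite divr_ge0 ?mulr_ge0 ?(ltW Hmu) ?(ltW Hrho2) //; exact: bigmax_ge_id.
Qed.

Lemma stationary_bound c X : 0 < c -> dG c X = 0 ->
  frobn (X - Wst) <= Num.sqrt N%:R * (K * c^-1).
Proof.
move=> c0 E; have [Y LY hY] := solve_zero_sum zero_sum_gradf_Wst.
have E' : gradf g X - gradf g Wst + c *: (Lap *m (X - Wst + c^-1 *: Y)) = 0.
  rewrite mulmxDr mulmxBr lap_consensus subr0 -scalemxAr LY scalerDr scalerA.
  by rewrite divff ?gt_eqF // scale1r [_ + gradf g Wst]addrC addrA subrK.
apply: le_trans (gap_bound (ltW c0) E') _.
have ci : 0 <= c^-1 by rewrite invr_ge0 ltW.
rewrite frobnZ ger0_norm //.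
have h : frobn Y <= Num.sqrt N%:R * nabla_star g wstar / rho 2%N.
  by apply: le_trans hY _; rewrite ler_pM2r ?invr_gt0 // frobn_gradf_Wst.
apply: le_trans (_ : L / mu * (c^-1 * (Num.sqrt N%:R * nabla_star g wstar / rho 2%N)) <= _).
  by rewrite ler_wpM2l ?divr_ge0 // ?(ltW Hmu) // ler_wpM2l.
rewrite le_eqVlt; apply/orP; left; apply/eqP; rewrite invfM; ring.
Qed.

(** The gradient at [Wst] plus L times the distance from X to [Wst]: this is the origin of the
    factor 1 + L^2 / (mu rho_2) eta_t / gamma_t in the drift. *)
Lemma stationary_gradf_bound c X : 0 < c -> dG c X = 0 ->
  frobn (gradf g X) <=
  Num.sqrt N%:R * (nabla_star g wstar * (1 + L ^+ 2 / (mu * rho 2%N) * c^-1)).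
Proof.
move=> c0 E; have -> : gradf g X = gradf g Wst + (gradf g X - gradf g Wst).
  by rewrite addrC subrK.
apply: le_trans (ler_frobnD _ _) _.
have h1 := frobn_gradf_Wst; have h2 := gradf_lipschitz Hsm L0 X Wst.
have h3 := ler_wpM2l L0 (stationary_bound c0 E).
apply: le_trans (lerD h1 (le_trans h2 h3)) _.
rewrite le_eqVlt; apply/orP; left; apply/eqP; ring.
Qed.

(** Subtracting the stationarity equations leaves (c - c') Lap X. As Lap X = - grad f (X) / c, the
    shift - (1/c - 1/c') Y with Lap Y = grad f (X) absorbs it; Y exists because grad f (X) is in the
    range of Lap, hence zero-sum. *)
Lemma stationary_drift c c' X X' : 0 < c -> c <= c' -> dG c X = 0 -> dG c' X' = 0 ->
  frobn (X' - X) <= Num.sqrt N%:R *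
    (K * ((1 + L ^+ 2 / (mu * rho 2%N) * c^-1) * (c^-1 - c'^-1))).
Proof.
move=> c0 cc' E E'; have c'0 : 0 < c' by apply: lt_le_trans cc'.
have gX : gradf g X = - (c *: (Lap *m X)) by apply/eqP; rewrite -addr_eq0 -/(dG c X) E.
have gX' : gradf g X' = - (c' *: (Lap *m X')) by apply/eqP; rewrite -addr_eq0 -/(dG c' X') E'.
have zs : zero_sum (gradf g X).
  by rewrite gX /zero_sum mulmxN -scalemxAr (zero_sum_lap Lsym L1) scaler0 oppr0.
have [Y LY hY] := solve_zero_sum zs.
have dc : 0 <= c^-1 - c'^-1 by rewrite subr_ge0 lef_pV2.
have EE : gradf g X' - gradf g X + c' *: (Lap *m (X' - X + (- (c^-1 - c'^-1)) *: Y)) = 0.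
  rewrite mulmxDr -scalemxAr LY gX' gX mulmxBr.
  apply/matrixP => i j; rewrite !mxE; set a := \sum_k _; set b := \sum_k _.
  by field; rewrite !gt_eqF.
apply: le_trans (gap_bound (ltW c'0) EE) _.
rewrite frobnZ normrN ger0_norm //.
have h : frobn Y <= Num.sqrt N%:R *
    (nabla_star g wstar * (1 + L ^+ 2 / (mu * rho 2%N) * c^-1)) / rho 2%N.
  by apply: le_trans hY _; rewrite ler_pM2r ?invr_gt0 // stationary_gradf_bound.
apply: le_trans (ler_wpM2l _ (ler_wpM2l dc h)) _; first by rewrite divr_ge0 // ltW.
rewrite le_eqVlt; apply/orP; left; apply/eqP; rewrite invfM; ring.
Qed.

End Consensus.

(** * Projected gradient dynamics *)

Section Dynamics.
Variables (R : realType) (N d : nat).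
Variables (f : 'I_N -> 'rV[R]_d -> R) (g : 'I_N -> 'rV[R]_d -> 'rV[R]_d) (mu L : R).
Hypotheses (HN : (2 <= N)%N) (Hmu : 0 < mu) (HmuL : mu <= L).
Hypothesis Hgrad : forall i, is_gradient (f i) (g i).
Hypothesis Hsc : forall i, strongly_convex mu (f i).
Hypothesis Hsm : forall i, lipschitz_grad L (g i).
Variable wstar : 'rV[R]_d.
Hypothesis Hmin : forall w, \sum_(i < N) f i wstar <= \sum_(i < N) f i w.
Variables (Lap : 'M[R]_N) (rho : nat -> R).
Hypotheses (Lsym : Lap^T = Lap) (L1 : Lap *m const_mx 1 = 0 :> 'cV[R]_N).
Hypothesis Hchar : char_poly Lap = \prod_(1 <= i < N.+1) ('X - (rho i)%:P).
Hypothesis Hsort : forall i j : nat,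
  (1 <= i)%N -> (i <= j)%N -> (j <= N)%N -> rho i <= rho j.
Hypothesis Hrho2 : 0 < rho 2%N.
Variable W : set 'rV[R]_d.
Hypotheses (HWcl : closed W) (HWcv : convex_set W) (HWb : bounded_set W).
Hypothesis HWst : W wstar.
Variables (eta gamma : nat -> R) (kbar : nat).
Hypotheses (Heta : forall k, 0 < eta k) (Hgamma : forall k, 0 < gamma k).
Hypothesis HC1 : forall k, (kbar <= k)%N -> eta k * (mu + L) + gamma k * rho N <= 2.
Hypothesis HC2 : forall k, (kbar <= k)%N ->
  eta k / gamma k * (Num.sqrt N%:R * nabla_star g wstar * L)
    <= zeta_of W wstar * mu * rho 2%N.
Hypothesis HC3 : forall k, (kbar <= k)%N -> gamma k / eta k <= gamma k.+1 / eta k.+1.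
Implicit Types X Y Z : 'M[R]_(N, d).

Local Notation c k := (gamma k / eta k).
Local Notation dG k := (grad_penalized g Lap (c k)).
Local Notation G k := (penalized f Lap (c k)).
Local Notation K := (nabla_star g wstar * L / (mu * rho 2%N)).
Local Notation Wstk k := (Wstar_k W f Lap eta gamma k).

Let c0 k : 0 < c k. Proof. by rewrite divr_gt0. Qed.
Let cV k : (c k)^-1 = eta k / gamma k. Proof. by rewrite invf_div. Qed.
Let W0 : W !=set0. Proof. by exists wstar. Qed.
Let Wcpt : compact W. Proof. exact: bounded_closed_compact. Qed.
Let sN : 0 < Num.sqrt N%:R :> R.
Proof. by rewrite sqrtr_gt0 ltr0n (leq_trans _ HN). Qed.

Let lo k : lower_quad mu (G k) (dG k).
Proof.
exact: (penalized_lower Hgrad Hsc Lsym (lap_quad_ge0 HN Lsym L1 Hchar Hsort Hrho2 (d := d)) (ltW (c0 k))).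
Qed.

Let up k : upper_quad (L + c k * rho N) (G k) (dG k).
Proof.
exact: (penalized_upper Hgrad Hsm Lsym (lap_quad_le Lsym Hchar Hsort (d := d)) (ltW (c0 k))).
Qed.

Lemma GkE k : Gk f Lap eta gamma k = G k.
Proof. by apply/funext => X; rewrite /Gk /penalized invfM [_^-1 * _]mulrC mulrA. Qed.

Lemma Wstar_stationary k : (kbar <= k)%N -> dG k (Wstk k) = 0 /\ setN W (Wstk k).
Proof.
move=> kk.
have cf i : continuous (f i).
  by move=> w; apply: differentiable_continuous; case: (Hgrad i w).
have [X X0] := exists_stationary Hmu (lo k) (up k) (continuous_penalized cf).
have SX : setN W X.
  move=> i; apply: (zeta_ball HWcl HWst).
  have -> : nrm (row i X - wstar) = frobn (row i (X - Wst N wstar)).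
    by rewrite nrmE rowB row_Wst.
  (* The bound for the whole matrix is spent on a single row; after clearing mu rho_2 it is (C2). *)
  apply: le_trans (le_frobn_row _ _) _.
  have := stationary_bound HN Hmu HmuL Hgrad Hsc Hsm Hmin Lsym L1 Hchar Hsort Hrho2 (c0 k) X0.
  move=> /le_trans; apply; rewrite cV.
  have m0 : 0 < mu * rho 2%N by rewrite mulr_gt0.
  rewrite -(ler_pM2r m0).
  apply: le_trans (_ : eta k / gamma k *
    (Num.sqrt N%:R * nabla_star g wstar * L) <= _).
    rewrite le_eqVlt; apply/orP; left; apply/eqP; field.
    by rewrite !gt_eqF.
  by apply: le_trans (HC2 kk) _; rewrite mulrA.
have minX Z : G k X <= G k Z.
  have := lo k X Z; rewrite X0 mdot0l addr0; apply: le_trans.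
  by rewrite lerDl mulr_ge0 ?divr_ge0 ?(ltW Hmu) // -frob2E frob2_ge0.
have vi Z : setN W Z -> 0 <= mdot (dG k X) (Z - X) by rewrite X0 mdot0l.
suff -> : Wstk k = X by [].
(* Strong convexity identifies the chosen minimizer with X, and X itself excludes the default value
   0. *)
rewrite /Wstar_k GkE /argmin_on; case: xgetP => [Q _ [SQ minQ]|/(_ X)[]].
  by apply: (minimizer_unique Hmu (lo k) vi SQ); exact: minQ.
by split.
Qed.

Lemma consensus_error k : (kbar <= k)%N ->
  (Num.sqrt N%:R)^-1 * frobn (Wstk k - Wst N wstar) <= K * (eta k / gamma k).
Proof.
move=> kk; have [E _] := Wstar_stationary kk.
rewrite mulrC ler_pdivrMr // mulrC -cV.
exact: (stationary_bound HN Hmu HmuL Hgrad Hsc Hsm Hmin Lsym L1 Hchar Hsort Hrho2).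
Qed.

Lemma minimizer_drift k : (kbar <= k)%N ->
  frobn (Wstk k - Wstk k.+1) <= Num.sqrt N%:R *
    (K * ((1 + L ^+ 2 / (mu * rho 2%N) * (eta k / gamma k)) *
          (eta k / gamma k - eta k.+1 / gamma k.+1))).
Proof.
move=> kk; have [E _] := Wstar_stationary kk.
have [E' _] := Wstar_stationary (leqW kk).
rewrite frobnB -!cV.
exact: (stationary_drift HN Hmu HmuL Hgrad Hsc Hsm Hmin Lsym L1 Hchar Hsort Hrho2 (c0 k) (HC3 kk) E E').
Qed.

Definition gstep k X := X - eta k *: dG k X.

(** As mu <= L and gamma_k rho_N >= 0, (C1) gives 2 mu eta_k <= 2. *)
Lemma eta_mu_le1 k : (kbar <= k)%N -> 0 <= 1 - mu * eta k.
Proof.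
move=> kk; have := HC1 kk.
have h1 : 0 <= gamma k * rho N.
  by rewrite mulr_ge0 ?(ltW (Hgamma k)) // (le_trans (ltW Hrho2)) // Hsort.
have := ler_wpM2l (ltW (Heta k)) HmuL; lra.
Qed.

Lemma gstep_contraction k X Y : (kbar <= k)%N ->
  frobn (gstep k X - gstep k Y) <= (1 - mu * eta k) * frobn (X - Y).
Proof.
move=> kk; rewrite [mu * _]mulrC.
have rN : 0 < rho N by apply: lt_le_trans Hrho2 _; apply: Hsort.
apply: (grad_step_contraction (l := L + c k * rho N) _ (lo k) (up k)); rewrite ?(ltW Hmu) ?(ltW (Heta k)) //.
  (* Cocoercivity needs m < l strictly; L may equal mu, and the penalty term c rho_N > 0 provides
     the gap. *)
  by apply: le_lt_trans HmuL _; rewrite ltrDl mulr_gt0.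
apply: le_trans (HC1 kk); rewrite le_eqVlt; apply/orP; left; apply/eqP.
by field; rewrite gt_eqF.
Qed.

Local Notation bar V0 n := (Witer W g Lap eta gamma kbar V0 (fun=> 0) (fun=> 0) n).
Local Notation pr := (Defs.proj (@setN R N d W)).

Lemma bar_step V0 n : bar V0 n.+1 = pr (gstep (kbar + n) (bar V0 n)).
Proof. by rewrite /= !scaler0 addr0 subr0. Qed.

Lemma Witer_in V0 e1 e2 n : setN W V0 ->
  setN W (Witer W g Lap eta gamma kbar V0 e1 e2 n).
Proof. by case: n => //= n _; exact: proj_in. Qed.

Lemma setN_diam X Y : setN W X -> setN W Y ->
  frobn (X - Y) <= Num.sqrt N%:R * diam W.
Proof.
move=> SX SY; apply: frobn_rows_le; first exact: diam_ge0.
by move=> i; rewrite rowB -nrmE; exact: nrm_diam.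
Qed.

Lemma Pprod_rec s k : (s <= k)%N -> Pprod mu eta s k.+1 = Pprod mu eta s k * (1 - mu * eta k).
Proof. by move=> sk; rewrite /Pprod big_nat_recr. Qed.

Lemma Pprod_id s : Pprod mu eta s s = 1.
Proof. by rewrite /Pprod big_geq. Qed.

(** The exponent is 1 for the tracking error and 2 for the mean squared gap. *)
Lemma Pprod_sum_rec (F : nat -> R) (e k : nat) : (kbar <= k)%N ->
  \sum_(kbar <= t < k.+1) Pprod mu eta t.+1 k.+1 ^+ e * F t =
  (1 - mu * eta k) ^+ e * (\sum_(kbar <= t < k) Pprod mu eta t.+1 k ^+ e * F t) + F k.
Proof.
move=> kk; rewrite big_nat_recr //= Pprod_id expr1n mul1r; congr (_ + _).
rewrite mulr_sumr; apply: eq_big_nat => t /andP[_ tk].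
by rewrite Pprod_rec // exprMn; ring.
Qed.

Lemma tracking_error V0 n : setN W V0 ->
  frobn (bar V0 n - Wstk (kbar + n)) <= Num.sqrt N%:R *
    (diam W * Pprod mu eta kbar (kbar + n) + K *
     \sum_(kbar <= t < kbar + n) Pprod mu eta t.+1 (kbar + n) *
                (1 + L ^+ 2 / (mu * rho 2%N) * (eta t / gamma t)) *
                (eta t / gamma t - eta t.+1 / gamma t.+1)).
Proof.
move=> SV; elim: n => [|n IH].
  (* At time kbar the product and the sum are empty; both points lie in W^N, whence the diameter. *)
  rewrite addn0 Pprod_id big_geq // !mulr0 addr0 mulr1.
  by apply: setN_diam => //; case: (Wstar_stationary (leqnn kbar)).
set k := (kbar + n)%N in IH *; have kk : (kbar <= k)%N by exact: leq_addr.
rewrite addnS -/k; apply: le_trans (ler_frobn_dist _ (Wstk k) _) _.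
have [E SE] := Wstar_stationary kk.
have h1 : frobn (bar V0 n.+1 - Wstk k) <= (1 - mu * eta k) * frobn (bar V0 n - Wstk k).
  (* W*_k has zero gradient, so its gradient step is itself and its variational inequality is
     trivial. *)
  apply: le_trans (gstep_contraction _ _ kk); rewrite bar_step.
  apply: (proj_nonexpansive (proj_in Wcpt W0 _) SE); first exact: proj_viP.
  by move=> Z SZ; rewrite /gstep E scaler0 subr0 subrr mdot0l.
have h2 := ler_wpM2l (eta_mu_le1 kk) IH.
apply: le_trans (lerD (le_trans h1 h2) (minimizer_drift kk)) _.
rewrite Pprod_rec //.
have S e F : \sum_(kbar <= t < e) Pprod mu eta t.+1 e * (F t) * (eta t / gamma t - eta t.+1 / gamma t.+1) =
   \sum_(kbar <= t < e) Pprod mu eta t.+1 e ^+ 1 * ((F t) * (eta t / gamma t - eta t.+1 / gamma t.+1)).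
  by apply: eq_bigr => t _; rewrite expr1 mulrA.
rewrite !(S _ (fun t => 1 + L ^+ 2 / (mu * rho 2%N) * (eta t / gamma t))) Pprod_sum_rec //.
rewrite expr1 le_eqVlt; apply/orP; left; apply/eqP; ring.
Qed.

Definition step_gap V0 e1 e2 n : 'M[R]_(N, d) :=
  gstep (kbar + n) (Witer W g Lap eta gamma kbar V0 e1 e2 n)
  - gstep (kbar + n) (bar V0 n).

Lemma step_gap_le V0 e1 e2 n :
  frob2 (step_gap V0 e1 e2 n) <= (1 - mu * eta (kbar + n)) ^+ 2 *
    frob2 (Witer W g Lap eta gamma kbar V0 e1 e2 n - bar V0 n).
Proof.
rewrite frob2E -sqr_frobn -[frob2 (_ - _)]sqr_sqrtr ?frob2_ge0 // -exprMn.
rewrite ler_sqr ?nnegrE ?mulr_ge0 ?frobn_ge0 ?sqrtr_ge0 ?eta_mu_le1 ?leq_addr //.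
by apply: gstep_contraction; exact: leq_addr.
Qed.

(** A pathwise bound that keeps the cross terms explicit, since they vanish only in mean. *)
Lemma noisy_step V0 (e1 e2 : nat -> 'M[R]_(N, d)) n k A : k = (kbar + n)%N ->
  A = step_gap V0 e1 e2 n ->
  frob2 (Witer W g Lap eta gamma kbar V0 e1 e2 n.+1 - bar V0 n.+1) <=
  (1 - mu * eta k) ^+ 2 *
    frob2 (Witer W g Lap eta gamma kbar V0 e1 e2 n - bar V0 n) +
  (2 * gamma k * mdot A (e1 k) - 2 * eta k * mdot A (e2 k) +
   gamma k ^+ 2 * frob2 (e1 k) + eta k ^+ 2 * frob2 (e2 k) -
   2 * gamma k * eta k * mdot (e1 k) (e2 k)).
Proof.
move=> kE AE; have h := step_gap_le V0 e1 e2 n; rewrite -AE -kE in h.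
apply: le_trans (lerD h (lexx _)).
apply: le_trans (_ : frob2 (A + gamma k *: e1 k - eta k *: e2 k) <= _); last first.
  rewrite !frob2E !(mdotDl, mdotDr, mdotNl, mdotNr, mdotZl, mdotZr).
  rewrite (mdotC (e1 k) A) (mdotC (e2 k) A) (mdotC (e2 k) (e1 k)).
  by rewrite le_eqVlt; apply/orP; left; apply/eqP; ring.
rewrite !frob2E -ler_frobn2 bar_step /= -kE.
set X' := (X in Defs.proj _ X).
have -> : A + gamma k *: e1 k - eta k *: e2 k = X' - gstep k (bar V0 n).
  by rewrite AE /step_gap -kE /X' /gstep; apply/matrixP => i j; rewrite !mxE; ring.
exact: (proj_nonexpansive (proj_in Wcpt W0 _) (proj_in Wcpt W0 _)
  (@proj_viP _ _ _ _ Wcpt HWcv W0 _) (@proj_viP _ _ _ _ Wcpt HWcv W0 _)).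
Qed.

Section Measurability.
Context dsp (T : measurableType dsp).

(** The contraction factor is at most 1, so each entry of the step is 1-Lipschitz and
    [measurable_lipschitz] applies. *)
Lemma measurable_gstep k (Y : T -> 'M[R]_(N, d)) : (kbar <= k)%N ->
  measurable_mx Y -> measurable_mx (fun w => gstep k (Y w)).
Proof.
move=> kk mY i j; apply: (measurable_lipschitz (phi := fun X => gstep k X i j)) => // X X'.
have -> : gstep k X i j - gstep k X' i j = (gstep k X - gstep k X') i j by rewrite !mxE.
apply: le_trans (entry_le_frobn _ _ _) _.
apply: le_trans (gstep_contraction _ _ kk) _.
rewrite -[leRHS]mul1r ler_wpM2r ?frobn_ge0 // gerBl mulr_ge0 //; exact: ltW.
Qed.

Lemma measurable_proj (Y : T -> 'M[R]_(N, d)) :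
  measurable_mx Y -> measurable_mx (fun w => pr (Y w)).
Proof.
move=> mY i j; apply: (measurable_lipschitz (phi := fun X => pr X i j)) => // X X'.
have -> : pr X i j - pr X' i j = (pr X - pr X') i j by rewrite !mxE.
apply: le_trans (entry_le_frobn _ _ _) _.
exact: (proj_nonexpansive (proj_in Wcpt W0 _) (proj_in Wcpt W0 _)
  (@proj_viP _ _ _ _ Wcpt HWcv W0 _) (@proj_viP _ _ _ _ Wcpt HWcv W0 _)).
Qed.

Lemma measurable_mxD (Y Z : T -> 'M[R]_(N, d)) : measurable_mx Y -> measurable_mx Z ->
  measurable_mx (fun w => Y w + Z w).
Proof.
move=> mY mZ i j; under eq_fun do rewrite mxE.
exact: measurable_funD.
Qed.

Lemma measurable_mxZ a (Y : T -> 'M[R]_(N, d)) : measurable_mx Y ->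
  measurable_mx (fun w => a *: Y w).
Proof.
move=> mY i j; under eq_fun do rewrite mxE.
exact: measurable_funM.
Qed.

Lemma measurable_mxB (Y Z : T -> 'M[R]_(N, d)) : measurable_mx Y -> measurable_mx Z ->
  measurable_mx (fun w => Y w - Z w).
Proof.
move=> mY mZ i j; under eq_fun do rewrite !mxE.
exact: measurable_funB.
Qed.

Lemma measurable_frob2 (Y : T -> 'M[R]_(N, d)) : measurable_mx Y ->
  measurable_fun setT (fun w => frob2 (Y w)).
Proof.
move=> mY; apply: measurable_sum => i; apply: measurable_sum => j.
exact: measurable_funX.
Qed.

End Measurability.

(** * Mean-square estimates *)

Section Probability.
Context (dsp : measure_display) (Om : measurableType dsp) (P : probability Om R).
Variable Fil : nat -> set (set Om).
Hypotheses (HFsig : forall k, sigma_algebra setT (Fil k))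
  (HFmeas : forall k, Fil k `<=` measurable) (HFinc : forall k, Fil k `<=` Fil k.+1).

Lemma Witer_Gmeas (V0 : Om -> 'M[R]_(N, d)) (e1 e2 : nat -> Om -> 'M[R]_(N, d)) n :
  Gmeas_mx (Fil kbar) V0 ->
  (forall k, (kbar <= k)%N -> Gmeas_mx (Fil k.+1) (e1 k)) ->
  (forall k, (kbar <= k)%N -> Gmeas_mx (Fil k.+1) (e2 k)) ->
  Gmeas_mx (Fil (kbar + n))
    (fun w => Witer W g Lap eta gamma kbar (V0 w) (e1^~ w) (e2^~ w) n).
Proof.
move=> mV m1 m2; elim: n => [|n IH]; first by rewrite addn0.
rewrite addnS; have kk : (kbar <= kbar + n)%N by exact: leq_addr.
(* The noise at time k is F_{k+1}-measurable, so the iterate is moved up the filtration to meet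
   it. *)
have {}IH : Gmeas_mx (Fil (kbar + n).+1)
    (fun w => Witer W g Lap eta gamma kbar (V0 w) (e1^~ w) (e2^~ w) n).
  by move=> i j B mB; apply: HFinc; exact: IH.
apply/(Gmeas_mxP (HFsig _)) => /=.
apply: measurable_proj; apply: measurable_mxB; last first.
  by apply: measurable_mxZ; apply/(Gmeas_mxP (HFsig _)); exact: m2.
apply: measurable_mxD; last first.
  by apply: measurable_mxZ; apply/(Gmeas_mxP (HFsig _)); exact: m1.
by apply: measurable_gstep => //; apply/(Gmeas_mxP (HFsig _)).
Qed.

Variable V0 : Om -> 'M[R]_(N, d).
Hypotheses (mV0 : Gmeas_mx (Fil kbar) V0) (SV0 : forall w, @setN R N d W (V0 w)).

Lemma bar_Gmeas n : Gmeas_mx (Fil (kbar + n)) (fun w => bar (V0 w) n).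
Proof.
have m0 k : Gmeas_mx (Fil k.+1) (fun _ : Om => 0 : 'M[R]_(N, d)).
  by apply/(Gmeas_mxP (HFsig _)) => i j; exact: measurable_cst.
exact: (Witer_Gmeas (e1 := fun _ _ => 0) (e2 := fun _ _ => 0)).
Qed.

Lemma bar_measurable n : measurable_mx (fun w => bar (V0 w) n).
Proof. by move=> i j; exact: (Gmeas_measurable (@HFmeas _) (@bar_Gmeas n i j)). Qed.

Variables e1 e2 : nat -> Om -> 'M[R]_(N, d).
Variables Sig1 Sig2 : R.
Hypothesis He1m : forall k, (kbar <= k)%N -> Gmeas_mx (Fil k.+1) (e1 k).
Hypothesis He2m : forall k, (kbar <= k)%N -> Gmeas_mx (Fil k.+1) (e2 k).
Hypothesis He1 : forall k, (kbar <= k)%N -> forall i j,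
  is_cond_exp P (Fil k) (fun w => e1 k w i j) (fun=> 0).
Hypothesis He2 : forall k, (kbar <= k)%N -> forall i j,
  is_cond_exp P (Fil k) (fun w => e2 k w i j) (fun=> 0).
Hypothesis He12 : forall k, (kbar <= k)%N -> is_cond_exp P (Fil k)
  (fun w => \sum_(i < N) \sum_(j < d) e1 k w i j * e2 k w i j) (fun=> 0).
Hypothesis Hv1 : forall k, (kbar <= k)%N -> exists Y : Om -> R,
  is_cond_exp P (Fil k) (fun w => frob2 (e1 k w)) Y /\
  {ae P, forall w, N%:R^-1 * Y w <= Sig1}.
Hypothesis Hv2 : forall k, (kbar <= k)%N -> exists Y : Om -> R,
  is_cond_exp P (Fil k) (fun w => frob2 (e2 k w)) Y /\
  {ae P, forall w, N%:R^-1 * Y w <= Sig2}.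

Local Notation noisy w n := (Witer W g Lap eta gamma kbar (V0 w) (e1^~ w) (e2^~ w) n).

Definition sq_gap n w : R := frob2 (noisy w n - bar (V0 w) n).

Let NR0 : 0 < N%:R :> R. Proof. by rewrite ltr0n (leq_trans _ HN). Qed.

Lemma noise_variance (e : nat -> Om -> 'M[R]_(N, d)) Sig k :
  (exists Y : Om -> R, is_cond_exp P (Fil k) (fun w => frob2 (e k w)) Y /\
    {ae P, forall w, N%:R^-1 * Y w <= Sig}) ->
  exists2 m, has_mean P (fun w => frob2 (e k w)) m & m <= N%:R * Sig.
Proof.
move=> [Y [hY YS]]; apply: (cond_exp_mean (HFsig k) hY).
by apply: filterS YS => w; rewrite ler_pdivrMl.
Qed.

Lemma noise_orthogonal (e : nat -> Om -> 'M[R]_(N, d)) k A M :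
  (forall i j, is_cond_exp P (Fil k) (fun w => e k w i j) (fun=> 0)) ->
  Gmeas_mx (Fil k) A -> (forall w, frobn (A w) <= M) ->
  has_mean P (fun w => mdot (A w) (e k w)) 0.
Proof.
move=> he mA AM; under eq_fun do rewrite mdotE.
apply: has_mean_sum0 => i; apply: has_mean_sum0 => j.
have AijM w : `|A w i j| <= M by apply: le_trans (entry_le_frobn _ _ _) (AM w).
split; last exact: (centered_mul (HFsig k) (@HFmeas k) (he i j) (mA i j) AijM).
apply: (integrable_bounded_mul (he i j) _ AijM).
exact: (Gmeas_measurable (@HFmeas k) (mA i j)).
Qed.

Lemma step_gap_bounded n w :
  frobn (step_gap (V0 w) (e1^~ w) (e2^~ w) n) <= Num.sqrt N%:R * diam W.
Proof.
have kk : (kbar <= kbar + n)%N by exact: leq_addr.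
apply: le_trans (gstep_contraction _ _ kk) _.
apply: (@le_trans _ _ (frobn (noisy w n - bar (V0 w) n))).
  by rewrite -[leRHS]mul1r ler_wpM2r ?frobn_ge0 // gerBl mulr_ge0 // ltW.
exact: (setN_diam (Witer_in _ _ n (SV0 w)) (Witer_in _ _ n (SV0 w))).
Qed.

Lemma step_gap_Gmeas n :
  Gmeas_mx (Fil (kbar + n)) (fun w => step_gap (V0 w) (e1^~ w) (e2^~ w) n).
Proof.
have kk : (kbar <= kbar + n)%N by exact: leq_addr.
apply/(Gmeas_mxP (HFsig _)).
apply: measurable_mxB; apply: measurable_gstep => //; apply/(Gmeas_mxP (HFsig _)).
  exact: (Witer_Gmeas n mV0 He1m He2m).
exact: bar_Gmeas.
Qed.

(** Both iterates stay in the bounded set W^N, so the squared gap is bounded; this is what makes its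
    [enorm] finite. *)
Lemma sq_gap_mean n : exists m, has_mean P (sq_gap n) m.
Proof.
exists (Rintegral P setT (sq_gap n)); split=> //.
have mX i j := Gmeas_measurable (@HFmeas _) (@Witer_Gmeas _ _ _ n mV0 He1m He2m i j).
apply: measurable_bounded_integrable => //.
- by apply: le_lt_trans (probability_le1 P measurableT) _; rewrite ltry.
- by apply: measurable_frob2; apply: measurable_mxB; [exact: mX|exact: bar_measurable].
exists ((Num.sqrt N%:R * diam W) ^+ 2); split; first exact: num_real.
move=> x Mx w _ /=; rewrite /sq_gap ger0_norm ?frob2_ge0 //.
apply: le_trans (ltW Mx); rewrite frob2E -ler_frobn ?mulr_ge0 ?sqrtr_ge0 ?diam_ge0 //.
exact: (setN_diam (Witer_in _ _ n (SV0 w)) (Witer_in _ _ n (SV0 w))).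
Qed.

Lemma sq_gap_step n m m' : has_mean P (sq_gap n) m -> has_mean P (sq_gap n.+1) m' ->
  m' <= (1 - mu * eta (kbar + n)) ^+ 2 * m +
    N%:R * (gamma (kbar + n) ^+ 2 * Sig1 + eta (kbar + n) ^+ 2 * Sig2).
Proof.
move=> hm hm'; set k := (kbar + n)%N; have kk : (kbar <= k)%N by exact: leq_addr.
have [v1 hv1 v1S] := noise_variance (Hv1 kk).
have [v2 hv2 v2S] := noise_variance (Hv2 kk).
have ho1 := noise_orthogonal (He1 kk) (@step_gap_Gmeas n) (step_gap_bounded n).
have ho2 := noise_orthogonal (He2 kk) (@step_gap_Gmeas n) (step_gap_bounded n).
have h12 : has_mean P (fun w => mdot (e1 k w) (e2 k w)) 0.
  by under eq_fun do rewrite mdotE; exact: (cond_exp0_mean (HFsig k) (He12 kk)).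
have H := has_meanD (has_meanZ ((1 - mu * eta k) ^+ 2) hm)
  (has_meanD (has_meanD (has_meanZ (2 * gamma k) ho1) (has_meanZ (- (2 * eta k)) ho2))
   (has_meanD (has_meanD (has_meanZ (gamma k ^+ 2) hv1) (has_meanZ (eta k ^+ 2) hv2))
     (has_meanZ (- (2 * gamma k * eta k)) h12))).
apply: le_trans (has_mean_le hm' H _) _.
  move=> w; rewrite /sq_gap.
  apply: le_trans (noisy_step (erefl : k = _) (erefl (step_gap (V0 w) (e1^~ w) (e2^~ w) n))) _.
  by rewrite le_eqVlt; apply/orP; left; apply/eqP; rewrite /=; ring.
have g2 := ler_wpM2l (sqr_ge0 (gamma k)) v1S.
have e2' := ler_wpM2l (sqr_ge0 (eta k)) v2S.
rewrite !mulr0 !add0r addr0 mulrDr; lra.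
Qed.

Lemma sq_gap_bound n m : has_mean P (sq_gap n) m ->
  m <= N%:R * \sum_(kbar <= t < kbar + n) Pprod mu eta t.+1 (kbar + n) ^+ 2 *
     (gamma t ^+ 2 * Sig1 + eta t ^+ 2 * Sig2).
Proof.
elim: n m => [|n IH] m hm.
  rewrite addn0 big_geq // mulr0.
  apply: (has_mean_le hm (has_mean_cst P 0)) => w.
  by rewrite /sq_gap subrr frob2E mdot0l.
have [m1 hm1] := sq_gap_mean n.
apply: le_trans (sq_gap_step hm1 hm) _.
rewrite addnS (Pprod_sum_rec _ 2) ?leq_addr //.
rewrite [leRHS]mulrDr lerD // mulrCA.
by rewrite ler_wpM2l ?sqr_ge0 // IH.
Qed.

Lemma noise_error n :
  (((Num.sqrt N%:R)^-1)%:E * enorm P (fun w => (noisy w n - bar (V0 w) n)%R)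
   <= (Num.sqrt (\sum_(kbar <= t < kbar + n)
              Pprod mu eta t.+1 (kbar + n) ^+ 2 *
              (gamma t ^+ 2 * Sig1 + eta t ^+ 2 * Sig2)))%:E)%E.
Proof.
have [m hm] := sq_gap_mean n; have := sq_gap_bound hm; set S := \sum_(_ <= _ < _) _ => mS.
have -> : enorm P (fun w => noisy w n - bar (V0 w) n) = (Num.sqrt m)%:E.
  rewrite /enorm; case: hm => im <-; rewrite /Rintegral.
  by have /fineK <- := integrable_fin_num measurableT im.
rewrite -EFinM lee_fin mulrC ler_pdivrMr // mulrC -sqrtrM ?(ltW NR0) //.
exact: ler_wsqrtr.
Qed.

(** The noise-free bound is uniform over the samples of W_kbar, so it passes to the mean square. *)
Lemma tracking_error_enorm n :
  (((Num.sqrt N%:R)^-1)%:E * enorm P (fun w => (bar (V0 w) n - Wstk (kbar + n))%R)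
   <= (diam W * Pprod mu eta kbar (kbar + n) + K *
     \sum_(kbar <= t < kbar + n) Pprod mu eta t.+1 (kbar + n) *
                (1 + L ^+ 2 / (mu * rho 2%N) * (eta t / gamma t)) *
                (eta t / gamma t - eta t.+1 / gamma t.+1))%:E)%E.
Proof.
set B := diam W * _ + _.
have hB w : frobn (bar (V0 w) n - Wstk (kbar + n)) <= Num.sqrt N%:R * B.
  exact: tracking_error.
(* The sign of B is inherited from the pathwise bound at one sample point. *)
have sB0 : 0 <= Num.sqrt N%:R * B by apply: le_trans (hB point); exact: frobn_ge0.
have B0 : 0 <= B by rewrite -(pmulr_rge0 _ sN).
pose q w := frob2 (bar (V0 w) n - Wstk (kbar + n)).
have qB w : q w <= (Num.sqrt N%:R * B) ^+ 2 by rewrite /q frob2E -ler_frobn.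
have mq : measurable_fun setT q.
  apply: measurable_frob2; apply: measurable_mxB; first exact: bar_measurable.
  by move=> i j; exact: measurable_cst.
have iq : has_mean P q (Rintegral P setT q).
  split=> //; apply: measurable_bounded_integrable => //.
    by apply: le_lt_trans (probability_le1 P measurableT) _; rewrite ltry.
  exists ((Num.sqrt N%:R * B) ^+ 2); split; first exact: num_real.
  move=> x Mx w _ /=; rewrite ger0_norm ?frob2_ge0 //.
  exact: le_trans (qB w) (ltW Mx).
have mean_le := has_mean_le iq (has_mean_cst P _) qB.
have -> : enorm P (fun w => bar (V0 w) n - Wstk (kbar + n)) = (Num.sqrt (Rintegral P setT q))%:E.
  rewrite /enorm /Rintegral; case: iq => im _.
  by have /fineK <- := integrable_fin_num measurableT im.
rewrite -EFinM lee_fin mulrC ler_pdivrMr // mulrC.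
by rewrite -[leRHS]ger0_norm // -sqrtr_sqr ler_wsqrtr.
Qed.

End Probability.

End Dynamics.

Theorem theorem1
  (R : realType) (N d : nat) (HN : (2 <= N)%N) (Hd : (1 <= d)%N)
  (* local objectives and their gradients *)
  (f : 'I_N -> 'rV[R]_d -> R) (g : 'I_N -> 'rV[R]_d -> 'rV[R]_d) (mu L : R)
  (Hmu : 0 < mu) (HmuL : mu <= L)
  (Hgrad : forall i, is_gradient (f i) (g i))
  (Hsc : forall i, strongly_convex mu (f i))
  (Hsm : forall i, lipschitz_grad L (g i))
  (* w* = unique minimizer of F = (1/N) sum_i f_i *)
  (wstar : 'rV[R]_d)
  (Hmin : forall w, N%:R^-1 * \sum_(i < N) f i wstar <= N%:R^-1 * \sum_(i < N) f i w)
  (Huniq : forall w', (forall w, N%:R^-1 * \sum_(i < N) f i w' <= N%:R^-1 * \sum_(i < N) f i w) ->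
                      w' = wstar)
  (* constraint set *)
  (W : set 'rV[R]_d) (HWne : W !=set0) (HWcl : closed W) (HWcv : convex_set W)
  (HWb : bounded_set W) (HWint : interior W wstar)
  (* Laplacian and its ordered eigenvalues *)
  (Lap : 'M[R]_N) (HLsym : Lap^T = Lap) (HLoff : forall i j : 'I_N, i != j -> Lap i j <= 0)
  (HL1 : Lap *m const_mx 1 = 0 :> 'cV[R]_N)
  (rho : nat -> R) (Hchar : char_poly Lap = \prod_(1 <= i < N.+1) ('X - (rho i)%:P))
  (Hsort : forall i j : nat, (1 <= i)%N -> (i <= j)%N -> (j <= N)%N -> rho i <= rho j)
  (Hrho2 : 0 < rho 2%N)
  (* stepsizes *)
  (eta gamma : nat -> R) (Heta : forall k, 0 < eta k) (Hgamma : forall k, 0 < gamma k)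
  (* probability space and filtration *)
  (dsp : measure_display) (Om : measurableType dsp) (P : probability Om R)
  (Fil : nat -> set (set Om)) (HFsig : forall k, sigma_algebra setT (Fil k))
  (HFmeas : forall k, Fil k `<=` measurable) (HFinc : forall k, Fil k `<=` Fil k.+1)
  (kbar : nat) (W0 : Om -> 'M[R]_(N, d))
  (HW0m : Gmeas_mx (Fil kbar) W0) (HW0S : forall w, @setN R N d W (W0 w))
  (* noises *)
  (e1 e2 : nat -> Om -> 'M[R]_(N, d)) (Sig1 Sig2 : R) (HSig1 : 0 <= Sig1) (HSig2 : 0 <= Sig2)
  (He1m : forall k, (kbar <= k)%N -> Gmeas_mx (Fil k.+1) (e1 k))
  (He2m : forall k, (kbar <= k)%N -> Gmeas_mx (Fil k.+1) (e2 k))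
  (He1 : forall k, (kbar <= k)%N -> forall i j,
           is_cond_exp P (Fil k) (fun w => e1 k w i j) (fun _ => 0))
  (He2 : forall k, (kbar <= k)%N -> forall i j,
           is_cond_exp P (Fil k) (fun w => e2 k w i j) (fun _ => 0))
  (He12 : forall k, (kbar <= k)%N ->
           is_cond_exp P (Fil k)
             (fun w => \sum_(i < N) \sum_(j < d) e1 k w i j * e2 k w i j) (fun _ => 0))
  (Hv1 : forall k, (kbar <= k)%N -> exists Y : Om -> R,
           is_cond_exp P (Fil k) (fun w => frob2 (e1 k w)) Y /\
           {ae P, forall w, N%:R^-1 * Y w <= Sig1})
  (Hv2 : forall k, (kbar <= k)%N -> exists Y : Om -> R,
           is_cond_exp P (Fil k) (fun w => frob2 (e2 k w)) Y /\
           {ae P, forall w, N%:R^-1 * Y w <= Sig2})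
  (* step-size conditions (C1)-(C3) *)
  (HC1 : forall k, (kbar <= k)%N -> eta k * (mu + L) + gamma k * rho N <= 2)
  (HC2 : forall k, (kbar <= k)%N ->
           eta k / gamma k * (Num.sqrt N%:R * nabla_star g wstar * L)
             <= zeta_of W wstar * mu * rho 2%N)
  (HC3 : forall k, (kbar <= k)%N -> gamma k / eta k <= gamma k.+1 / eta k.+1) :
  forall k, (kbar <= k)%N ->
  [/\ (((Num.sqrt N%:R)^-1)%:E *
         enorm P (fun w => (Wk W g Lap eta gamma kbar (W0 w) (fun t => e1 t w) (fun t => e2 t w) k
                           - Wbark W g Lap eta gamma kbar (W0 w) k)%R)
       <= (Num.sqrt (\sum_(kbar <= t < k)
              Pprod mu eta t.+1 k ^+ 2 * (gamma t ^+ 2 * Sig1 + eta t ^+ 2 * Sig2)))%:E)%E,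
      (((Num.sqrt N%:R)^-1)%:E *
         enorm P (fun w => (Wbark W g Lap eta gamma kbar (W0 w) k - Wstar_k W f Lap eta gamma k)%R)
       <= (diam W * Pprod mu eta kbar k
           + nabla_star g wstar * L / (mu * rho 2%N) *
             \sum_(kbar <= t < k) Pprod mu eta t.+1 k *
                (1 + L ^+ 2 / (mu * rho 2%N) * (eta t / gamma t)) *
                (eta t / gamma t - eta t.+1 / gamma t.+1))%:E)%E
    & (Num.sqrt N%:R)^-1 *
        frobn (Wstar_k W f Lap eta gamma k - \matrix_(i < N, j < d) wstar ord0 j)
      <= nabla_star g wstar * L / (mu * rho 2%N) * (eta k / gamma k)].
Proof.
move=> k kk; have [n ->] : exists n, k = (kbar + n)%N.
  by exists (k - kbar)%N; rewrite subnKC.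
rewrite /Wk /Wbark addKn.
have N0 : 0 < N%:R^-1 :> R by rewrite invr_gt0 ltr0n (leq_trans _ HN).
have Fmin w : \sum_(i < N) f i wstar <= \sum_(i < N) f i w.
  by have := Hmin w; rewrite ler_pM2l.
have Wwstar : W wstar by exact: interior_subset HWint.
split.
- exact: (noise_error HN Hmu HmuL Hgrad Hsc Hsm HLsym HL1 Hchar Hsort Hrho2
    HWcl HWcv HWb Wwstar Heta Hgamma HC1 HFsig HFmeas HFinc HW0m HW0S
    He1m He2m He1 He2 He12 Hv1 Hv2).
- exact: (tracking_error_enorm HN Hmu HmuL Hgrad Hsc Hsm Fmin HLsym HL1 Hchar
    Hsort Hrho2 HWcl HWcv HWb Wwstar Heta Hgamma HC1 HC2 HC3 P
    HFsig HFmeas HFinc HW0m HW0S).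
- exact: (consensus_error HN Hmu HmuL Hgrad Hsc Hsm Fmin HLsym HL1 Hchar Hsort
    Hrho2 HWcl Wwstar Heta Hgamma HC2 (leq_addr n kbar)).
Qed.
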